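(* Let $D$ be a (finite-dimensional) central division algebra over a field $F$. Assume $v$ is a valuation on $F$ which extends to a valuation on $D$ so that $D$ is tame over $F$. Let $\sigma$ be an involution of the first kind on $D$ and let $L\subseteq D$ be a subfield Galois over $F$, consisting of $\sigma$-symmetric elements. If $D$ is totally ramified over its subalgebra $C_D(L)$, then the involution $\sigma\otimes\mathrm{id}_L$ on $D\otimes_FL$ is anisotropic.
   Context: An involution of the first kind on $D$ is an $F$-linear map $\sigma\colon D\to D$ with $\sigma(xy)=\sigma(y)\sigma(x)$ and $\sigma^2=\mathrm{id}$ (so $\sigma$ is the identity on the center $F$); $x$ is $\sigma$-symmetric if $\sigma(x)=x$. An involution $\tau$ on an algebra is anisotropic if $\tau(x)x=0$ only for $x=0$. $C_D(L)$ is the centralizer of $L$ in $D$. Let $v_D$ be the valuation on $D$ extending $v$; $\Gamma_D=v_D(D^\times)$, and for a division subring $C\subseteq D$, $\Gamma_C=v_D(C^\times)$. $D$ is totally ramified over $C$ if $|\Gamma_D:\Gamma_C|=[D:C]$ (the dimension of $D$ as a right $C$-vector space). Let $\mathrm{gr}(D)=\bigoplus_\gamma D^{\ge\gamma}/D^{>\gamma}$ be the graded ring associated with the filtration $D^{\ge\gamma}=\{x\mid v_D(x)\ge\gamma\}$, $D^{>\gamma}=\{x\mid v_D(x)>\gamma\}$; similarly $\mathrm{gr}(F)\subseteq\mathrm{gr}(D)$. $D$ is tame over $F$ means that $v_D$ is a tame $v$-gauge, i.e. $[\mathrm{gr}(D):\mathrm{gr}(F)]=[D:F]$ and $Z(\mathrm{gr}(D))=\mathrm{gr}(F)$.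 (Equivalently: $D$ remains a division algebra over a Henselization $F_h$ of $F$ and is split by the maximal tamely ramified extension of $F_h$.) *)

(* Defs.v *)
From HB Require Import structures.
From mathcomp Require Import all_boot all_order all_algebra all_field.
From mathcomp Require Import finmap.
From mathcomp Require Import monalg.

Set Implicit Arguments.
Unset Strict Implicit.
Unset Printing Implicit Defensive.

Import Order.TTheory GRing.Theory.

Local Open Scope fset_scope.
Local Open Scope ring_scope.
Local Open Scope quotient_scope.

HB.mixin Record isOrderedGroup G of Num.POrderedZmodule G := {
  og_total : total (<=%R : rel G);
  og_lerD2l : forall z x y : G, x <= y -> z + x <= z + y
}.

(* Totally ordered abelian groups. *)
#[short(type="orderedGroupType")]
HB.structure Definition OrderedGroup :=
  {G of isOrderedGroup G & Num.POrderedZmodule G}.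

Section OrderedGroupTheory.
Variable G : orderedGroupType.
Implicit Types x y z t : G.

Lemma og_leD2l z x y : (z + x <= z + y) = (x <= y).
Proof.
apply/idP/idP; last exact: og_lerD2l.
by move/(og_lerD2l (- z)); rewrite !addKr.
Qed.

Lemma og_leD2r z x y : (x + z <= y + z) = (x <= y).
Proof. by rewrite ![_ + z]addrC og_leD2l. Qed.

Lemma og_ltD2l z x y : (z + x < z + y) = (x < y).
Proof. by rewrite !lt_neqAle og_leD2l (inj_eq (addrI z)). Qed.

Lemma og_ltD2r z x y : (x + z < y + z) = (x < y).
Proof. by rewrite ![_ + z]addrC og_ltD2l. Qed.

Lemma og_leD x y z t : x <= y -> z <= t -> x + z <= y + t.
Proof.
by move=> xy zt; apply: (@le_trans _ _ (y + z)); rewrite ?og_leD2l ?og_leD2r.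
Qed.

Lemma og_lt_leD x y z t : x < y -> z <= t -> x + z < y + t.
Proof.
by move=> xy zt; apply: (@lt_le_trans _ _ (y + z)); rewrite ?og_leD2l ?og_ltD2r.
Qed.

Lemma og_le_ltD x y z t : x <= y -> z < t -> x + z < y + t.
Proof. by move=> xy zt; rewrite addrC [y + t]addrC; apply: og_lt_leD. Qed.

Lemma og_comparable x y : x >=< y.
Proof. exact: og_total. Qed.

Lemma og_dbl_eq0 x : x + x = 0 -> x = 0.
Proof.
move=> xx0; case: (comparable_ltgtP (og_comparable x 0)) => // lx.
  by have := og_lt_leD lx (ltW lx); rewrite xx0 addr0 ltxx.
by have := og_lt_leD lx (ltW lx); rewrite xx0 addr0 ltxx.
Qed.
End OrderedGroupTheory.

(* The value of a valuation at 0 is irrelevant; by convention it is +oo, which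
   is why 0 belongs to every set of the filtrations below. *)
Record valuation (R : nzRingType) (G : orderedGroupType) := Valuation {
  val_fun :> R -> G;
  valM : forall x y, x != 0 -> y != 0 -> val_fun (x * y) = val_fun x + val_fun y;
  valD : forall x y, x != 0 -> y != 0 -> x + y != 0 ->
    Order.min (val_fun x) (val_fun y) <= val_fun (x + y)
}.

Definition extends (F : fieldType) (D : falgType F) (G : orderedGroupType)
    (vD : valuation D G) (v : valuation F G) : Prop :=
  forall c : F, c != 0 -> vD c%:A = v c.

Section Filtration.
Variables (R : nzRingType) (G : orderedGroupType) (v : valuation R G).
Implicit Types (x y : R) (g h : G).

Definition filt_ge g : {pred R} := fun x => (x == 0) || (g <= v x).
Definition filt_gt g : {pred R} := fun x => (x == 0) || (g < v x).

Lemma filt_geE g x : (x \in filt_ge g) = (x == 0) || (g <= v x).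
Proof. by []. Qed.

Lemma filt_gtE g x : (x \in filt_gt g) = (x == 0) || (g < v x).
Proof. by []. Qed.

Lemma val1 : v 1 = 0.
Proof.
have := valM v (oner_neq0 R) (oner_neq0 R); rewrite mulr1 => e.
by apply: (@addrI _ (v 1)); rewrite addr0.
Qed.

Lemma valN x : v (- x) = v x.
Proof.
have [->|x0] := eqVneq x 0; first by rewrite oppr0.
have N1 : (-1 : R) != 0 by rewrite oppr_eq0 oner_neq0.
have vN1 : v (-1) = 0.
  by apply: og_dbl_eq0; rewrite -valM // mulrNN mulr1 val1.
by rewrite -mulN1r valM // vN1 add0r.
Qed.

Lemma filt_ge_zmod g : zmod_closed (filt_ge g).
Proof.
split=> [|x y]; rewrite !filt_geE ?eqxx //.
have [->|x0] := eqVneq x 0; first by rewrite sub0r oppr_eq0 valN.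
have [->|y0] := eqVneq y 0; first by rewrite subr0 (negPf x0).
have [//|xy0] := eqVneq (x - y) 0; rewrite /= => gx gy.
apply: le_trans (valD v x0 _ xy0); rewrite ?oppr_eq0 //.
by rewrite valN comparable_le_min ?og_comparable // gx gy.
Qed.

Lemma filt_gt_zmod g : zmod_closed (filt_gt g).
Proof.
split=> [|x y]; rewrite !filt_gtE ?eqxx //.
have [->|x0] := eqVneq x 0; first by rewrite sub0r oppr_eq0 valN.
have [->|y0] := eqVneq y 0; first by rewrite subr0 (negPf x0).
have [//|xy0] := eqVneq (x - y) 0; rewrite /= => gx gy.
apply: lt_le_trans (valD v x0 _ xy0); rewrite ?oppr_eq0 //.
by rewrite valN comparable_lt_min ?og_comparable // gx gy.
Qed.

HB.instance Definition _ g := GRing.isZmodClosed.Build R (filt_ge g) (filt_ge_zmod g).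
HB.instance Definition _ g := GRing.isZmodClosed.Build R (filt_gt g) (filt_gt_zmod g).

Lemma filt_geM g h x y :
  x \in filt_ge g -> y \in filt_ge h -> x * y \in filt_ge (g + h).
Proof.
rewrite !filt_geE; have [->|x0] := eqVneq x 0; first by rewrite mul0r eqxx.
have [->|y0] := eqVneq y 0; first by rewrite mulr0 eqxx.
by rewrite /= => gx hy; rewrite valM // og_leD // orbT.
Qed.

Lemma filt_gtMl g h x y :
  x \in filt_gt g -> y \in filt_ge h -> x * y \in filt_gt (g + h).
Proof.
rewrite filt_geE !filt_gtE; have [->|x0] := eqVneq x 0; first by rewrite mul0r eqxx.
have [->|y0] := eqVneq y 0; first by rewrite mulr0 eqxx.
by rewrite /= => gx hy; rewrite valM // og_lt_leD // orbT.
Qed.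

Lemma filt_gtMr g h x y :
  x \in filt_ge g -> y \in filt_gt h -> x * y \in filt_gt (g + h).
Proof.
rewrite filt_geE !filt_gtE; have [->|x0] := eqVneq x 0; first by rewrite mul0r eqxx.
have [->|y0] := eqVneq y 0; first by rewrite mulr0 eqxx.
by rewrite /= => gx hy; rewrite valM // og_le_ltD // orbT.
Qed.
End Filtration.

(* The group ring R[G] of finitely supported functions G -> R, with the
   convolution product; {malg R[G]} only has a ring structure in the library
   when G is a conical monoid. *)
Definition group_ring (R : nzRingType) (G : orderedGroupType) := {malg R[G]}.

Section GroupRing.
Variables (R : nzRingType) (G : orderedGroupType).
Implicit Types a b c : {malg R[G]}.

HB.instance Definition _ := GRing.Zmodule.on (group_ring R G).

Definition gr_one : {malg R[G]} := << 1 *g 0 >>.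
Definition gr_mul a b : {malg R[G]} :=
  \sum_(g <- msupp a) \sum_(h <- msupp b) << a@_g * b@_h *g g + h >>.

Lemma gr_mulw (d1 d2 : {fset G}) a b : msupp a `<=` d1 -> msupp b `<=` d2 ->
  gr_mul a b = \sum_(g <- d1) \sum_(h <- d2) << a@_g * b@_h *g g + h >>.
Proof.
move=> le1 le2; rewrite /gr_mul (big_fset_incl _ le1) /=.
  apply: eq_bigr => g _; apply/big_fset_incl => // h _ /mcoeff_outdom ->.
  by rewrite mulr0 monalgU0.
move=> g _ /mcoeff_outdom e.
by rewrite big1 => // h _; rewrite e mul0r monalgU0.
Qed.

Lemma gr_mulDl : left_distributive gr_mul +%R.
Proof.
move=> a b c.
rewrite (gr_mulw (msuppD_le a b) (fsubset_refl (msupp c))).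
rewrite (gr_mulw (fsubsetUl (msupp a) (msupp b)) (fsubset_refl (msupp c))).
rewrite (gr_mulw (fsubsetUr (msupp a) (msupp b)) (fsubset_refl (msupp c))).
rewrite -big_split; apply: eq_bigr => g _.
by rewrite -big_split; apply: eq_bigr => h _; rewrite mcoeffD mulrDl monalgUD.
Qed.

Lemma gr_mulDr : right_distributive gr_mul +%R.
Proof.
move=> c a b.
rewrite (gr_mulw (fsubset_refl (msupp c)) (msuppD_le a b)).
rewrite (gr_mulw (fsubset_refl (msupp c)) (fsubsetUl (msupp a) (msupp b))).
rewrite (gr_mulw (fsubset_refl (msupp c)) (fsubsetUr (msupp a) (msupp b))).
rewrite -big_split; apply: eq_bigr => g _.
by rewrite -big_split; apply: eq_bigr => h _; rewrite mcoeffD mulrDr monalgUD.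
Qed.

Lemma gr_mul0g : left_zero 0 gr_mul.
Proof. by move=> a; rewrite /gr_mul msupp0 big_seq_fset0. Qed.

Lemma gr_mulg0 : right_zero 0 gr_mul.
Proof. by move=> a; rewrite /gr_mul big1 // => g _; rewrite msupp0 big_seq_fset0. Qed.

Lemma gr_mulUU x y g h : gr_mul << x *g g >> << y *g h >> = << x * y *g g + h >>.
Proof. by rewrite (gr_mulw msuppU_le msuppU_le) !big_seq_fset1 !mcoeffUU. Qed.

Lemma gr_mul_suml I (r : seq I) (f : I -> {malg R[G]}) b :
  gr_mul (\sum_(i <- r) f i) b = \sum_(i <- r) gr_mul (f i) b.
Proof. exact: (big_morph (gr_mul^~ b) (fun a a' => gr_mulDl a a' b) (gr_mul0g b)). Qed.

Lemma gr_mul_sumr I (r : seq I) (f : I -> {malg R[G]}) b :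
  gr_mul b (\sum_(i <- r) f i) = \sum_(i <- r) gr_mul b (f i).
Proof. exact: (big_morph (gr_mul b) (gr_mulDr b) (gr_mulg0 b)). Qed.

Lemma gr_mulA : associative gr_mul.
Proof.
move=> a b c; rewrite (monalgE a) !gr_mul_suml; apply: eq_bigr => g _.
rewrite (monalgE b) !(gr_mul_suml, gr_mul_sumr); apply: eq_bigr => h _.
rewrite (monalgE c) !gr_mul_sumr; apply: eq_bigr => k _.
by rewrite !gr_mulUU mulrA addrA.
Qed.

Lemma gr_mul1g : left_id gr_one gr_mul.
Proof.
move=> a; rewrite {1}(monalgE a) gr_mul_sumr [RHS]monalgE; apply: eq_bigr => g _.
by rewrite gr_mulUU mul1r add0r.
Qed.

Lemma gr_mulg1 : right_id gr_one gr_mul.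
Proof.
move=> a; rewrite {1}(monalgE a) gr_mul_suml [RHS]monalgE; apply: eq_bigr => g _.
by rewrite gr_mulUU mulr1 addr0.
Qed.

Lemma gr_one_neq0 : gr_one != 0.
Proof. by rewrite monalgU_eq0 oner_neq0. Qed.

HB.instance Definition _ := GRing.Zmodule_isNzRing.Build (group_ring R G)
  gr_mulA gr_mul1g gr_mulg1 gr_mulDl gr_mulDr gr_one_neq0.

Lemma gr_coefM (a b : group_ring R G) k :
  (a * b)@_k = \sum_(g <- msupp a) \sum_(h <- msupp b)
                 (a@_g * b@_h) *+ (g + h == k).
Proof.
rewrite [a * b]/(gr_mul a b) /gr_mul raddf_sum; apply: eq_bigr => g _.
by rewrite raddf_sum; apply: eq_bigr => h _; rewrite /= mcoeffU.
Qed.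

Lemma gr_coef0 k : (0 : group_ring R G)@_k = 0.
Proof. exact: mcoeff0. Qed.

Lemma gr_coefB (a b : group_ring R G) k : (a - b)@_k = a@_k - b@_k.
Proof. exact: mcoeffB. Qed.
End GroupRing.

(* gr(R) is built as (\bigoplus_g R^{>= g}) / (\bigoplus_g R^{> g}), the
   numerator being a subring of the group ring R[G]. *)
Section AssociatedGraded.
Variables (R : nzRingType) (G : orderedGroupType) (v : valuation R G).

Definition sum_ge : {pred group_ring R G} :=
  fun a => all (fun g => a@_g \in filt_ge v g) (msupp a).

Lemma sum_geP (a : group_ring R G) :
  reflect (forall g, a@_g \in filt_ge v g) (a \in sum_ge).
Proof.
apply: (iffP allP) => [H g|H g _]; last exact: H.
by case: msuppP => [gs|_]; [apply: H | rewrite rpred0].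
Qed.

Lemma sum_ge_subring : subring_closed sum_ge.
Proof.
split=> [|a b /sum_geP Ha /sum_geP Hb|a b /sum_geP Ha /sum_geP Hb]; apply/sum_geP => k.
- rewrite [1]/(gr_one R G) mcoeffU; case: eqP => [<-|_]; last by rewrite rpred0.
  by rewrite filt_geE val1 lexx orbT.
- by rewrite gr_coefB rpredB.
rewrite gr_coefM; apply: rpred_sum => g _; apply: rpred_sum => h _.
by case: eqP => [<-|_]; [rewrite filt_geM | rewrite rpred0].
Qed.

HB.instance Definition _ :=
  GRing.isSubringClosed.Build (group_ring R G) sum_ge sum_ge_subring.

Record filt_sum := FiltSum { filt_sum_val :> group_ring R G; _ : filt_sum_val \in sum_ge }.
HB.instance Definition _ := [isSub for filt_sum_val].
HB.instance Definition _ := [Choice of filt_sum by <:].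
HB.instance Definition _ := [SubChoice_isSubNzRing of filt_sum by <:].

Definition sum_gt : {pred filt_sum} :=
  fun a => all (fun g => (val a)@_g \in filt_gt v g) (msupp (val a)).

Lemma sum_gtP (a : filt_sum) :
  reflect (forall g, (val a)@_g \in filt_gt v g) (a \in sum_gt).
Proof.
apply: (iffP allP) => [H g|H g _]; last exact: H.
by case: msuppP => [gs|_]; [apply: H | rewrite rpred0].
Qed.

Lemma sum_gt_zmod : zmod_closed sum_gt.
Proof.
split=> [|a b /sum_gtP Ha /sum_gtP Hb]; apply/sum_gtP => g.
  by rewrite rmorph0 gr_coef0 rpred0.
by rewrite rmorphB gr_coefB rpredB.
Qed.

HB.instance Definition _ := GRing.isZmodClosed.Build filt_sum sum_gt sum_gt_zmod.

Lemma filt_sumP (a : filt_sum) g : (val a)@_g \in filt_ge v g.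
Proof. exact: (sum_geP _ (valP a)). Qed.

Lemma sum_gtMl (a b : filt_sum) : a \in sum_gt -> a * b \in sum_gt.
Proof.
move=> /sum_gtP Ha; apply/sum_gtP => k; rewrite rmorphM gr_coefM.
apply: rpred_sum => g _; apply: rpred_sum => h _.
case: eqP => [<-|_]; last by rewrite rpred0.
by rewrite filt_gtMl ?filt_sumP.
Qed.

Lemma sum_gtMr (a b : filt_sum) : b \in sum_gt -> a * b \in sum_gt.
Proof.
move=> /sum_gtP Hb; apply/sum_gtP => k; rewrite rmorphM gr_coefM.
apply: rpred_sum => g _; apply: rpred_sum => h _.
case: eqP => [<-|_]; last by rewrite rpred0.
by rewrite filt_gtMr ?filt_sumP.
Qed.

Definition gr := Quotient.quot sum_gt.
HB.instance Definition _ := GRing.Zmodule.on gr.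

Definition to_gr (a : filt_sum) : gr := \pi_(Quotient.quot sum_gt) a.

Lemma to_gr_eq (a b : filt_sum) : (to_gr a == to_gr b) = (a - b \in sum_gt).
Proof. by rewrite /to_gr -Quotient.idealrBE. Qed.

Lemma to_gr_repr (x : gr) : to_gr (repr (x : Quotient.quot sum_gt)) = x.
Proof. exact: reprK. Qed.

Lemma to_grB : {morph to_gr : a b / a - b}.
Proof. exact: (raddfB (\pi_(Quotient.quot sum_gt))). Qed.

Lemma to_grD : {morph to_gr : a b / a + b}.
Proof. exact: (raddfD (\pi_(Quotient.quot sum_gt))). Qed.

Definition one_gr : gr := to_gr 1.
Definition mul_gr (x y : gr) : gr :=
  to_gr (repr (x : Quotient.quot sum_gt) * repr (y : Quotient.quot sum_gt)).

Lemma to_grM : {morph to_gr : a b / a * b >-> mul_gr a b}.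
Proof.
move=> a b; apply/eqP; rewrite /mul_gr to_gr_eq.
set a' := repr _; set b' := repr _.
have Ha : a - a' \in sum_gt by rewrite -to_gr_eq to_gr_repr.
have Hb : b - b' \in sum_gt by rewrite -to_gr_eq to_gr_repr.
have -> : a * b - a' * b' = (a - a') * b + a' * (b - b').
  by rewrite mulrBl mulrBr addrA subrK.
by apply: rpredD; [apply: sum_gtMl | apply: sum_gtMr].
Qed.

Lemma mul_grA : associative mul_gr.
Proof.
move=> x y z; rewrite -(to_gr_repr x) -(to_gr_repr y) -(to_gr_repr z).
by rewrite -!to_grM mulrA.
Qed.

Lemma mul_1gr : left_id one_gr mul_gr.
Proof. by move=> x; rewrite -(to_gr_repr x) /one_gr -to_grM mul1r. Qed.

Lemma mul_gr1 : right_id one_gr mul_gr.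
Proof. by move=> x; rewrite -(to_gr_repr x) /one_gr -to_grM mulr1. Qed.

Lemma mul_grDl : left_distributive mul_gr +%R.
Proof.
move=> x y z; rewrite -(to_gr_repr x) -(to_gr_repr y) -(to_gr_repr z).
by rewrite -to_grD -!to_grM -to_grD mulrDl.
Qed.

Lemma mul_grDr : right_distributive mul_gr +%R.
Proof.
move=> x y z; rewrite -(to_gr_repr x) -(to_gr_repr y) -(to_gr_repr z).
by rewrite -to_grD -!to_grM -to_grD mulrDr.
Qed.

Lemma one_gr_neq0 : one_gr != 0.
Proof.
have -> : 0 = to_gr 0 by rewrite -(subrr (0 : filt_sum)) to_grB subrr.
rewrite to_gr_eq subr0; apply/negP => /sum_gtP /(_ 0).
by rewrite rmorph1 [X in X@_0]/(gr_one R G) mcoeffUU filt_gtE val1 ltxx oner_eq0.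
Qed.

HB.instance Definition _ := GRing.Zmodule_isNzRing.Build gr
  mul_grA mul_1gr mul_gr1 mul_grDl mul_grDr one_gr_neq0.

(* For a subring S of R, the image in gr(R) of the graded ring of the
   restriction of v to S. *)
Definition gr_sub (S : {pred R}) (x : gr) : Prop :=
  exists2 a : filt_sum, forall g, (val a)@_g \in S & x = to_gr a.
End AssociatedGraded.

(* A is a free right module of rank n over its subring S.  The rank is unique
   in both uses below: S is a division ring, or commutative (gr(F)). *)
Definition right_rank (A : nzRingType) (S : A -> Prop) (n : nat) : Prop :=
  exists e : 'I_n -> A, forall x : A,
    exists! c : {ffun 'I_n -> A}, (forall i, S (c i)) /\ x = \sum_i e i * c i.

Definition central_elt (A : nzRingType) (x : A) : Prop := forall y : A, x * y = y * x.

(* The index |K : H| of abelian groups H <= K is n; t is a transversal. *)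
Definition has_index (G : zmodType) (K H : G -> Prop) (n : nat) : Prop :=
  exists2 t : 'I_n -> G, forall i, K (t i) &
    forall g, K g -> exists! i, H (g - t i).

Definition value_group (R : nzRingType) (G : orderedGroupType)
    (v : valuation R G) (S : {pred R}) (g : G) : Prop :=
  exists x, [/\ x \in S, x != 0 & v x = g].

Section DivisionAlgebra.
Variables (F : fieldType) (D : falgType F).

Definition central_division_algebra : Prop :=
  (forall x : D, x != 0 -> x \is a GRing.unit) /\ ('Z({:D}) = 1)%VS.

Definition tame (G : orderedGroupType) (vD : valuation D G) : Prop :=
  let grF := gr_sub (v := vD) [in 1%VS] in
  right_rank grF (\dim {:D}) /\ (forall x : gr vD, central_elt x <-> grF x).

Definition totally_ramified (G : orderedGroupType) (vD : valuation D G)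
    (C : {vspace D}) : Prop :=
  exists2 n, right_rank [in C] n &
    has_index (value_group vD [in {:D}%VS]) (value_group vD [in C]) n.

Definition first_kind_involution (s : D -> D) : Prop :=
  [/\ linear s, {morph s : x y / x * y >-> y * x} & involutive s].
End DivisionAlgebra.

Definition anisotropic (A : nzRingType) (t : A -> A) : Prop :=
  forall x, t x * x = 0 -> x = 0.

(* A (x)_F B, an element x standing for \sum_i e_i (x) x_i, where e is the
   basis of A chosen by the library; universal property: [tensP]. *)
Definition tensor (F : fieldType) (A : falgType F) (B : algType F) :=
  {ffun 'I_(\dim {:A}) -> B}.

Section Tensor.
Variables (F : fieldType) (A : falgType F) (B : algType F).
Local Notation T := (tensor A B).
Local Notation e := (vbasis {:A}).

HB.instance Definition _ := GRing.Lmodule.on T.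

Definition tens (a : A) (b : B) : T := [ffun i => coord e i a *: b].

Lemma tens_linearl b : linear (tens^~ b).
Proof.
move=> k a a'; apply/ffunP => i; rewrite !ffunE.
have -> : coord e i (k *: a + a') = k * coord e i a + coord e i a' by exact: linearP.
by rewrite scalerDl scalerA.
Qed.

Lemma tens_linearr a : linear (tens a).
Proof.
move=> k b b'; apply/ffunP => i; rewrite !ffunE scalerDr !scalerA.
by rewrite [k * _]mulrC.
Qed.

HB.instance Definition _ a :=
  GRing.isLinear.Build F B T *:%R (tens a) (tens_linearr a).

Definition tensl b := tens^~ b.
HB.instance Definition _ b :=
  GRing.isLinear.Build F A T *:%R (tensl b) (tens_linearl b).

Lemma tens_expand (x : T) : x = \sum_(i < \dim {:A}) tens e`_i (x i).
Proof.
apply/ffunP => k; rewrite sum_ffunE (bigD1 k) //= big1 => [|i ik].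
  by rewrite addr0 ffunE coord_free ?eqxx ?scale1r // (basis_free (vbasisP _)).
rewrite ffunE coord_free ?(basis_free (vbasisP _)) //.
by rewrite (negPf ik) scale0r.
Qed.

Lemma tensP (V : lmodType F) (f : A -> B -> V) :
    (forall b, linear (f^~ b)) -> (forall a, linear (f a)) ->
  exists2 h : {linear T -> V}, forall a b, h (tens a b) = f a b &
    forall h' : {linear T -> V}, (forall a b, h' (tens a b) = f a b) -> h' =1 h.
Proof.
move=> fl fr.
pose Fr a : {linear B -> V} := HB.pack (f a) (GRing.isLinear.Build F B V *:%R (f a) (fr a)).
pose Fl b : {linear A -> V} :=
  HB.pack (f^~ b) (GRing.isLinear.Build F A V *:%R (f^~ b) (fl b)).
pose h0 (x : T) := \sum_(i < \dim {:A}) f e`_i (x i).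
have h0l : linear h0.
  move=> k x y; rewrite /h0 scaler_sumr -big_split; apply: eq_bigr => i _ /=.
  by rewrite !ffunE; apply: fr.
pose h : {linear T -> V} := HB.pack h0 (GRing.isLinear.Build F T V *:%R h0 h0l).
have hE a b : h (tens a b) = f a b.
  rewrite /= /h0 [in RHS](coord_vbasis (memvf a)).
  rewrite -[RHS]/(Fl b _) linear_sum; apply: eq_bigr => i _.
  by rewrite ffunE -[LHS]/(Fr _ _) !linearZ.
exists h => // h' h'E x; rewrite (tens_expand x) !linear_sum.
by apply: eq_bigr => i _; rewrite h'E hE.
Qed.

Definition tens_one : T := tens 1 1.
Definition tens_mul (x y : T) : T :=
  \sum_(i < \dim {:A}) \sum_(j < \dim {:A}) tens (e`_i * e`_j) (x i * y j).

Lemma tens_mulDl : left_distributive tens_mul +%R.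
Proof.
move=> x y z; rewrite /tens_mul -big_split; apply: eq_bigr => i _ /=.
by rewrite -big_split; apply: eq_bigr => j _ /=; rewrite ffunE mulrDl linearD.
Qed.

Lemma tens_mulDr : right_distributive tens_mul +%R.
Proof.
move=> x y z; rewrite /tens_mul -big_split; apply: eq_bigr => i _ /=.
by rewrite -big_split; apply: eq_bigr => j _ /=; rewrite ffunE mulrDr linearD.
Qed.

Lemma tens_mul0l : left_zero 0 tens_mul.
Proof.
by move=> x; apply: (@addrI _ (tens_mul 0 x)); rewrite -tens_mulDl !addr0.
Qed.

Lemma tens_mul0r : right_zero 0 tens_mul.
Proof.
by move=> x; apply: (@addrI _ (tens_mul x 0)); rewrite -tens_mulDr !addr0.
Qed.

Lemma tens_mul_suml I (r : seq I) (f : I -> T) y :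
  tens_mul (\sum_(i <- r) f i) y = \sum_(i <- r) tens_mul (f i) y.
Proof. exact: (big_morph (tens_mul^~ y) (fun a b => tens_mulDl a b y) (tens_mul0l y)). Qed.

Lemma tens_mul_sumr I (r : seq I) (f : I -> T) y :
  tens_mul y (\sum_(i <- r) f i) = \sum_(i <- r) tens_mul y (f i).
Proof. exact: (big_morph (tens_mul y) (tens_mulDr y) (tens_mul0r y)). Qed.

Lemma tens_mulE a b a' b' : tens_mul (tens a b) (tens a' b') = tens (a * a') (b * b').
Proof.
rewrite /tens_mul {2}(coord_vbasis (memvf a)) mulr_suml.
rewrite -[RHS]/(tensl _ _) linear_sum; apply: eq_bigr => i _.
rewrite {2}(coord_vbasis (memvf a')) mulr_sumr linear_sum; apply: eq_bigr => j _.
rewrite !ffunE -!scalerAl -!scalerAr.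
by rewrite [LHS]linearZ [RHS]linearZ /= [in LHS]linearZ [in RHS]linearZ.
Qed.

Lemma tens_mulA : associative tens_mul.
Proof.
move=> x y z; rewrite (tens_expand x) !tens_mul_suml; apply: eq_bigr => i _.
rewrite (tens_expand y) !(tens_mul_suml, tens_mul_sumr); apply: eq_bigr => j _.
rewrite (tens_expand z) !tens_mul_sumr; apply: eq_bigr => k _.
by rewrite !tens_mulE -?tens_expand !mulrA.
Qed.

Lemma tens_mul1l : left_id tens_one tens_mul.
Proof.
move=> x; rewrite {1}(tens_expand x) tens_mul_sumr [RHS]tens_expand.
by apply: eq_bigr => i _; rewrite tens_mulE !mul1r.
Qed.

Lemma tens_mul1r : right_id tens_one tens_mul.
Proof.
move=> x; rewrite {1}(tens_expand x) tens_mul_suml [RHS]tens_expand.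
by apply: eq_bigr => i _; rewrite tens_mulE !mulr1.
Qed.

Lemma tens_one_neq0 : tens_one != 0.
Proof.
apply/eqP => /ffunP h; have /eqP[] := oner_neq0 A.
rewrite (coord_vbasis (memvf 1)) big1 // => i _.
have /eqP := h i; rewrite !ffunE scaler_eq0 oner_eq0 orbF => /eqP ->.
by rewrite scale0r.
Qed.

HB.instance Definition _ := GRing.Zmodule_isNzRing.Build T
  tens_mulA tens_mul1l tens_mul1r tens_mulDl tens_mulDr tens_one_neq0.

Lemma tensM a b a' b' : tens a b * tens a' b' = tens (a * a') (b * b').
Proof. exact: tens_mulE. Qed.
End Tensor.

(* s (x) t, for F-linear s and t. *)
Definition tens_map (F : fieldType) (A : falgType F) (B : algType F)
    (s : A -> A) (t : B -> B) (x : tensor A B) : tensor A B :=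
  \sum_(i < \dim {:A}) tens (s (vbasis {:A})`_i) (t (x i)).

Lemma tens_mapE (F : fieldType) (A : falgType F) (B : algType F)
    (s : {linear A -> A}) (t : {linear B -> B}) (a : A) (b : B) :
  tens_map s t (tens a b) = tens (s a) (t b).
Proof.
rewrite /tens_map [in RHS](coord_vbasis (memvf a)) linear_sum.
rewrite -[RHS]/(tensl _ _) linear_sum; apply: eq_bigr => i _.
by rewrite ffunE !linearZ.
Qed.

(* Main.v *)
From HB Require Import structures.
Require Import Defs.
From mathcomp Require Import all_boot all_order all_fingroup all_algebra all_field.
From mathcomp Require Import finmap monalg.
From mathcomp Require Import boolp.

Set Implicit Arguments.
Unset Strict Implicit.
Unset Printing Implicit Defensive.

Import Order.TTheory GRing.Theory.
Local Open Scope ring_scope.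

(** Write v for the valuation of D, C for the centralizer of L and [x, y] for
    x y - y x.  The Galois group of L decomposes D, as a bimodule over L, into
    eigenspaces D_g = {x | x l = g(l) x}; the summand at the identity is C, and
    x^-1 y lies in C whenever x and y are nonzero in the same D_g.  The algebra
    D (x) L acts faithfully on D by (d (x) l) y = d y l, and if s denotes the
    projection of D onto C, then h(y, z) = s (sigma(y) z) is a hermitian form for
    which sigma (x) id is the adjoint involution.  Since sigma(D_g) = D_{g^-1},
    the eigenspaces are orthogonal, so h(Y, Y) is the sum of the
    sigma(Y_g) Y_g.  Hence, if (sigma (x) id)(t) t = 0 and Y = t y, this sum
    vanishes.  The term at g has value 2 v(Y_g), because v is the only extension
    of its restriction to F (val_unique) and so v o sigma = v.  If these values
    are pairwise distinct, every Y_g is zero, hence t = 0.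

    It remains to see that elements of distinct eigenspaces have distinct values.
    Otherwise some quotient z = x^-1 y has value 0, does not lie in C, and still
    satisfies z l = f(l) z with f(l) in L.  Total ramification yields z = c + m
    with c in C and v(m) outside the value group of C (ram_decompose).  Then
    (f(l) - l) z = [z, l] = [m, l], and as L is contained in C the value of the
    left-hand side lies in the value group of C.  So it suffices to find l in L
    with v([m, l]) = v(m) + v(l) (exists_noncommuting); this says that gr(C) is
    the centralizer of gr(L) in gr(D), and it is where tameness is used.

    Two consequences of tameness are enough: every subspace of D has a basis on
    which v is the minimum of the values of the terms (exists_vindep_basis), and
    an element whose leading term is central has the leading term of a scalar
    (tame_residually_central).  The second one carries over to leading terms the
    classical argument of Artin and Whaples: leading terms of elements e_i
    independent over F admit no relation sum_i e_i y d_i = 0 valid for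
    all y (artin_whaples).  If m commuted with L up to leading terms, one could
    solve fewer than [L : F] linear equations in the d_i and produce such a
    relation.  For the trivial valuation, artin_whaples also gives the
    faithfulness of the action of D (x) L. *)

(** * Valuations on division rings *)

Definition division_ring (R : unitRingType) := forall x : R, x != 0 -> x \is a GRing.unit.

Section OrderedGroupMore.
Variable G : orderedGroupType.
Implicit Types g h : G.

Lemma og_leNgt g h : (g <= h) = ~~ (h < g).
Proof. exact/comparable_leNgt/og_comparable. Qed.

Lemma og_ltNge g h : (g < h) = ~~ (h <= g).
Proof. exact/comparable_ltNge/og_comparable. Qed.

Lemma og_dbl_inj g h : g + g = h + h -> g = h.
Proof.
move=> e; apply/eqP; rewrite -subr_eq0; apply/eqP/og_dbl_eq0.
by rewrite addrACA -opprD e subrr.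
Qed.
End OrderedGroupMore.

Section Valuations.
Variables (R : unitRingType) (hU : division_ring R) (G : orderedGroupType).
Variable (v : valuation R G).
Implicit Types (x y z : R) (g h : G).

Lemma divring_mulf_neq0 x y : x != 0 -> y != 0 -> x * y != 0.
Proof.
move=> x0 y0; apply: contra_neq y0 => xy0.
by rewrite -(mulKr (hU x0) y) xy0 mulr0.
Qed.

Lemma divring_invr_neq0 x : x != 0 -> x^-1 != 0.
Proof. by move=> /hU; rewrite -unitrV; apply: contraTneq => ->; rewrite unitr0. Qed.

Lemma valV x : x != 0 -> v x^-1 = - v x.
Proof.
move=> x0; apply: (addrI (v x)).
by rewrite -Defs.valM ?divring_invr_neq0 // divrr ?hU // Defs.val1 subrr.
Qed.

Lemma filt_gtN g x : (x \notin filt_gt v g) = (x != 0) && (v x <= g).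
Proof. by rewrite filt_gtE negb_or -og_leNgt. Qed.

Lemma filt_geN g x : (x \notin filt_ge v g) = (x != 0) && (v x < g).
Proof. by rewrite filt_geE negb_or -og_ltNge. Qed.

Lemma filt_gtW g x : x \in filt_gt v g -> x \in filt_ge v g.
Proof. by rewrite filt_gtE filt_geE => /orP[->//|/ltW->]; rewrite orbT. Qed.

Lemma filt_gt_le g h x : h <= g -> x \in filt_gt v g -> x \in filt_gt v h.
Proof. by rewrite !filt_gtE => hg /orP[->//|/(le_lt_trans hg)->]; rewrite orbT. Qed.

Lemma filt_ge_val x : x \in filt_ge v (v x).
Proof. by rewrite filt_geE lexx orbT. Qed.

Lemma filt_gt_val x : x \in filt_gt v (v x) -> x = 0.
Proof. by rewrite filt_gtE ltxx orbF => /eqP. Qed.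

Lemma filt_ge_lt g h x : h < g -> x \in filt_ge v g -> x \in filt_gt v h.
Proof. by rewrite filt_gtE filt_geE => hg /orP[->//|/(lt_le_trans hg)->]; rewrite orbT. Qed.

Lemma filt_ge_eq g x : x \in filt_ge v g -> x \notin filt_gt v g -> x != 0 /\ v x = g.
Proof.
rewrite filt_gtN filt_geE => + /andP[x0 xg].
by rewrite (negPf x0) /= => gx; split=> //; apply/le_anti; rewrite xg.
Qed.

Lemma val_addl x y : x != 0 -> y \in filt_gt v (v x) -> x + y != 0 /\ v (x + y) = v x.
Proof.
move=> x0 ly; have xge := filt_ge_val x.
apply: filt_ge_eq; first by rewrite rpredD // filt_gtW.
apply: contra x0 => h; apply/eqP/(@filt_gt_val x).
by rewrite -[X in X \in _](addrK y) rpredB.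
Qed.

Lemma filt_gt_mull x y g : x != 0 -> (x * y \in filt_gt v (v x + g)) = (y \in filt_gt v g).
Proof.
move=> x0; have [->|y0] := eqVneq y 0; first by rewrite mulr0 !rpred0.
by rewrite !filt_gtE (negPf y0) (negPf (divring_mulf_neq0 x0 y0)) Defs.valM // og_ltD2l.
Qed.

Lemma filt_gt_mulr x y g : x != 0 -> (y * x \in filt_gt v (g + v x)) = (y \in filt_gt v g).
Proof.
move=> x0; have [->|y0] := eqVneq y 0; first by rewrite mul0r !rpred0.
by rewrite !filt_gtE (negPf y0) (negPf (divring_mulf_neq0 y0 x0)) Defs.valM // og_ltD2r.
Qed.

(** The strong form of the ultrametric inequality. It is used twice: for right
    C-combinations of representatives of the cosets of the value group of C, and
    for the sum of the sigma(Y_g) Y_g. *)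
Lemma val_sum_distinct (I : eqType) (r : seq I) (x : I -> R) : uniq r ->
  {in r &, forall i j, i != j -> x i != 0 -> x j != 0 -> v (x i) != v (x j)} ->
  {in r, forall i, x i = 0} \/
  exists2 j, j \in r &
    [/\ x j != 0, \sum_(i <- r) x i != 0 & v (\sum_(i <- r) x i) = v (x j)].
Proof.
elim: r => [|i r IH] /=; first by left.
case/andP=> ir ur dist; rewrite big_cons.
have [|rest0|[j jr [xj0 s0 vs]]] := IH ur.
- by move=> a b ar br; apply: dist; rewrite inE (ar, br) orbT.
- have -> : \sum_(k <- r) x k = 0 by rewrite big_seq big1.
  rewrite addr0; have [xi0|xi0] := eqVneq (x i) 0; last first.
    by right; exists i; rewrite ?mem_head.
  by left=> k; rewrite inE => /predU1P[->|/rest0].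
have [xi0|xi0] := eqVneq (x i) 0.
  by right; exists j; rewrite ?inE ?jr ?orbT // xi0 add0r.
have ij : i != j by apply: contraNneq ir => ->.
have vij : v (x i) != v (x j) by apply: dist; rewrite ?mem_head // inE jr orbT.
right; case: (comparable_ltgtP (og_comparable (v (x i)) (v (x j)))) => lt_ij.
- exists i; rewrite ?mem_head //.
  by have [] // := @val_addl (x i) (\sum_(k <- r) x k) xi0;
    rewrite ?filt_gtE ?vs ?lt_ij ?orbT.
- exists j; rewrite ?inE ?jr ?orbT //; rewrite addrC.
  by have [] := @val_addl (\sum_(k <- r) x k) (x i) s0;
    rewrite ?filt_gtE vs ?lt_ij ?orbT.
by rewrite lt_ij eqxx in vij.
Qed.
End Valuations.

(** * Leading terms in the associated graded ring *)

Section Graded.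
Variables (R : unitRingType) (hU : division_ring R) (G : orderedGroupType).
Variable (v : valuation R G).
Implicit Types (x y z : R) (g h : G).

Lemma monom_sum_ge g x : x \in filt_ge v g -> (<< x *g g >> : group_ring R G) \in sum_ge v.
Proof.
by move=> xg; apply/sum_geP => h; rewrite mcoeffU; case: eqP => [<-|_]; rewrite ?mulr1n ?rpred0.
Qed.

(** The default value makes monom total; it is meaningful for x of value at
    least g only. *)
Definition monom g x : filt_sum v := insubd 0 (<< x *g g >> : group_ring R G).
Definition lead g x : gr v := to_gr (monom g x).

Lemma monomE g x : x \in filt_ge v g -> val (monom g x) = << x *g g >>.
Proof. by move=> xg; rewrite /monom val_insubd monom_sum_ge. Qed.

Lemma leadB g x y : x \in filt_ge v g -> y \in filt_ge v g ->
  lead g (x - y) = lead g x - lead g y.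
Proof.
move=> xg yg; rewrite /lead -to_grB; congr to_gr; apply: val_inj.
by rewrite rmorphB /= !monomE ?rpredB // monalgUB.
Qed.

Lemma to_gr0 : to_gr (0 : filt_sum v) = 0.
Proof. by rewrite -(subrr (0 : filt_sum v)) to_grB subrr. Qed.

Lemma lead0 g : lead g 0 = 0.
Proof. by rewrite -(subrr (0 : R)) leadB ?rpred0 // subrr. Qed.

Lemma leadD g x y : x \in filt_ge v g -> y \in filt_ge v g ->
  lead g (x + y) = lead g x + lead g y.
Proof.
move=> xg yg; rewrite -[y in LHS]opprK leadB ?rpredN //.
by rewrite -[- y]sub0r leadB ?rpred0 // lead0 sub0r opprK.
Qed.

Lemma lead_eq0 g x : x \in filt_ge v g -> (lead g x == 0) = (x \in filt_gt v g).
Proof.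
move=> xg; rewrite -to_gr0 to_gr_eq subr0; apply/sum_gtP/idP => [/(_ g)|xgt h].
  by rewrite monomE // mcoeffU eqxx.
by rewrite monomE // mcoeffU; case: eqP => [<-|_]; rewrite ?mulr1n ?rpred0.
Qed.

Lemma leadM g h x y : x \in filt_ge v g -> y \in filt_ge v h ->
  lead g x * lead h y = lead (g + h) (x * y).
Proof.
move=> xg yh; rewrite /lead -[LHS]/(mul_gr _ _) -to_grM; congr to_gr; apply: val_inj.
rewrite rmorphM /= !monomE ?filt_geM //.
exact: gr_mulUU.
Qed.

Lemma to_gr_lead (a : filt_sum v) :
  to_gr a = \sum_(g <- msupp (val a)) lead g (val a)@_g.
Proof.
rewrite /lead -(big_morph _ (@to_grD _ _ v) to_gr0); congr to_gr; apply: val_inj.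
rewrite raddf_sum /= [LHS]monalgE; apply: eq_bigr => g _.
by rewrite monomE ?filt_sumP.
Qed.

Lemma gr_sub_lead (S : {pred R}) g x : 0 \in S -> x \in S ->
  x \in filt_ge v g -> gr_sub (v := v) S (lead g x).
Proof.
move=> S0 Sx xg; exists (monom g x) => // h; rewrite monomE // mcoeffU.
by case: eqP => [_|]; rewrite ?mulr1n ?mulr0n.
Qed.

Lemma lead_gr_sub (S : {pred R}) g x : x \in filt_ge v g -> gr_sub (v := v) S (lead g x) ->
  exists2 s, s \in S & x - s \in filt_gt v g.
Proof.
move=> xg [a Sa /eqP]; rewrite to_gr_eq => /sum_gtP/(_ g).
rewrite rmorphB /= gr_coefB monomE // mcoeffU eqxx mulr1n => h.
by exists (val a)@_g.
Qed.

(** Homogeneous elements generate gr(R) additively, so centrality is tested on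
    the leading terms of the y. *)
Lemma lead_central g x : x \in filt_ge v g ->
  (forall y, y != 0 -> x * y - y * x \in filt_gt v (g + v y)) ->
  central_elt (lead g x).
Proof.
move=> xg comm y; rewrite -(to_gr_repr y) to_gr_lead mulr_sumr mulr_suml.
apply: eq_bigr => h _; set a := mcoeff _ _.
have ah : a \in filt_ge v h by exact: filt_sumP.
have xa : x * a \in filt_ge v (g + h) by rewrite filt_geM.
have ax : a * x \in filt_ge v (g + h) by rewrite addrC filt_geM.
apply/eqP; rewrite !leadM // [h + g]addrC -subr_eq0 -leadB // lead_eq0; last exact: rpredB.
have [->|a0] := eqVneq a 0; first by rewrite mulr0 mul0r rpredB ?rpred0.
apply: filt_gt_le (comm a a0).
by rewrite og_leD2l; move: ah; rewrite filt_geE (negPf a0).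
Qed.
End Graded.

(** * Rank over the centre of a ring *)

Section Centre.
Variable A : nzRingType.

(** For a tame valuation the centre of gr(D) is gr(F). Bundling it as a
    commutative ring gives access to matrices, hence to the invariance of the
    rank. *)
Definition centre : {pred A} := fun x => `[< central_elt x >].

Lemma centreP x : reflect (central_elt x) (x \in centre).
Proof. exact: asboolP. Qed.

Lemma centre_subring : subring_closed centre.
Proof.
split=> [|x y /centreP cx /centreP cy|x y /centreP cx /centreP cy]; apply/centreP => z.
- by rewrite mul1r mulr1.
- by rewrite mulrBl mulrBr cx cy.
by rewrite -mulrA cy !mulrA cx.
Qed.

HB.instance Definition _ := GRing.isSubringClosed.Build A centre centre_subring.

Record centre_type := CentreType { centre_val :> A; _ : centre_val \in centre }.
HB.instance Definition _ := [isSub for centre_val].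
HB.instance Definition _ := [Choice of centre_type by <:].
HB.instance Definition _ := [SubChoice_isSubNzRing of centre_type by <:].

Lemma centre_mulC : @commutative centre_type centre_type *%R.
Proof. by move=> x y; apply: val_inj; rewrite !rmorphM; have /centreP := valP x. Qed.

HB.instance Definition _ := GRing.PzSemiRing_hasCommutativeMul.Build centre_type centre_mulC.

Lemma centre_lift (I : finType) (a : I -> A) : (forall i, central_elt (a i)) ->
  exists b : I -> centre_type, forall i, a i = val (b i).
Proof.
move=> ca; apply: (@fin_all_exists I (fun=> centre_type) (fun i b => a i = val b)) => i.
by exists (CentreType (introT (centreP _) (ca i))).
Qed.

(** A basis of n elements is expressed in the k generators and conversely; by
    uniqueness of coordinates the two matrices over the centre compose to the
    identity of size n. *)
Lemma centre_rank n k (w : 'I_k -> A) : right_rank (@central_elt A) n ->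
    (forall x, exists2 a : 'I_k -> A, forall i, central_elt (a i) & x = \sum_i w i * a i) ->
  (n <= k)%N.
Proof.
move=> [e e_basis] w_gen.
have /fin_all_exists[a aE] : forall j : 'I_n, exists a : 'I_k -> centre_type,
    e j = \sum_i w i * val (a i).
  move=> j; have [a /centre_lift[b ab] ->] := w_gen (e j).
  by exists b; apply: eq_bigr => i _; rewrite ab.
have /fin_all_exists[b bE] : forall i : 'I_k, exists b : 'I_n -> centre_type,
    w i = \sum_j e j * val (b j).
  move=> i; have [c [[/centre_lift[b bc] ->] _]] := e_basis (w i).
  by exists b; apply: eq_bigr => j _; rewrite bc.
apply: (@mulmx1_min _ n k (\matrix_(j, i) a j i) (\matrix_(i, j) b i j)).
apply/matrixP => j j'; rewrite !mxE; apply: val_inj.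
have [c [_ c_uniq]] := e_basis (e j).
pose c1 := [ffun l : 'I_n => val (\sum_i a j i * b i l)].
pose c2 := [ffun l : 'I_n => val ((j == l)%:R : centre_type)].
have c1c : c = c1.
  apply: c_uniq; split=> [l|]; first by rewrite ffunE; apply/centreP/valP.
  rewrite {1}aE; under eq_bigr do rewrite bE mulr_suml.
  rewrite exchange_big; apply: eq_bigr => l _ /=.
  rewrite ffunE raddf_sum mulr_sumr; apply: eq_bigr => i _.
  by rewrite -mulrA; congr (_ * _); rewrite -[LHS]/(val (b i l * a j i)) centre_mulC.
have c2c : c = c2.
  apply: c_uniq; split=> [l|]; first by rewrite ffunE; apply/centreP/valP.
  rewrite (bigD1 j) //= ffunE eqxx rmorph1 mulr1 big1 ?addr0 // => l lj.
  by rewrite ffunE eq_sym (negPf lj) rmorph0 mulr0.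
have := congr1 (fun f : {ffun _} => f j') (etrans (esym c1c) c2c).
rewrite !ffunE => <-; congr val; apply: eq_bigr => i _; by rewrite !mxE.
Qed.
End Centre.

Lemma exists_min_seq (T : eqType) (G : orderedGroupType) (s : seq T) (f : T -> G) :
  s != [::] -> exists2 m, m \in s & {in s, forall x, f m <= f x}.
Proof.
elim: s => // x s IH _; have [->|/IH[m ms mmin]] := eqVneq s [::].
  by exists x; rewrite ?mem_head // => y; rewrite inE => /eqP ->.
have /orP[le|le] := og_comparable (f x) (f m).
  exists x; rewrite ?mem_head // => y; rewrite inE => /predU1P[->//|/mmin].
  exact: le_trans.
exists m; rewrite ?inE ?ms ?orbT // => y; rewrite inE => /predU1P[->//|].
exact: mmin.
Qed.

(** * Valuation-independent families *)

Section ValuedAlgebra.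
Variables (F : fieldType) (D : falgType F) (hU : division_ring D).
Variables (G : orderedGroupType) (v : valuation D G).
Implicit Types (x y z d u : D) (g h : G) (k : F) (e : seq D) (U : {vspace D}).

Lemma alg_neq0 k : k != 0 -> k%:A != 0 :> D.
Proof. by rewrite scaler_eq0 oner_eq0 orbF. Qed.

Lemma valZ k x : k != 0 -> x != 0 -> v (k *: x) = v k%:A + v x.
Proof. by move=> k0 x0; rewrite -(mulr_algl k x) Defs.valM ?alg_neq0. Qed.

Lemma filt_gtZ k x g : k != 0 -> (k *: x \in filt_gt v (v k%:A + g)) = (x \in filt_gt v g).
Proof. by move=> k0; rewrite -(mulr_algl k x) filt_gt_mull ?alg_neq0. Qed.

(** The leading terms of the entries of e are linearly independent over gr(F).
    The recursive form makes it easy to enlarge a family by one element at a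
    time, which is always added in front. *)
Fixpoint vindep e : Prop :=
  if e is d :: e' then
    (forall u, u \in <<e'>>%VS -> d - u \notin filt_gt v (v d)) /\ vindep e'
  else True.

Lemma vindep_neq0 d e : vindep (d :: e) -> d != 0.
Proof. by case=> /(_ 0 (mem0v _)) + _; rewrite subr0; apply: contraNneq => ->; rewrite rpred0. Qed.

(** If k d had too small a value, then dividing by k would bring an element of
    the span of e closer to d than vindep allows. *)
Lemma vindep_cons_gt d e k u g : vindep (d :: e) -> u \in <<e>>%VS ->
  k *: d + u \in filt_gt v g -> k *: d \in filt_gt v g /\ u \in filt_gt v g.
Proof.
move=> ind ue sum_gt; suff kd : k *: d \in filt_gt v g.
  by split=> //; rewrite -[u](addKr (k *: d)) rpredD ?rpredN.
have [->|k0] := eqVneq k 0; first by rewrite scale0r rpred0.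
have d0 := vindep_neq0 ind; case: ind => ind _.
apply/negPn/negP; rewrite filt_gtN valZ // => /andP[_ le_g].
have u'e : - (k^-1 *: u) \in <<e>>%VS by rewrite rpredN rpredZ.
have /negP[] := ind _ u'e.
by rewrite opprK -(filt_gtZ _ _ k0) scalerDr scalerA divff // scale1r; apply: filt_gt_le sum_gt.
Qed.

Lemma vindep_cons_ge d e k u g : vindep (d :: e) -> u \in <<e>>%VS ->
  k *: d + u \in filt_ge v g -> k *: d \in filt_ge v g /\ u \in filt_ge v g.
Proof.
move=> ind ue sum_ge; suff kd : k *: d \in filt_ge v g.
  by split=> //; rewrite -[u](addKr (k *: d)) rpredD ?rpredN.
apply/negPn/negP; rewrite filt_geN => /andP[kd0 lt_g].
have [/filt_gt_val/eqP] := vindep_cons_gt ind ue (filt_ge_lt lt_g sum_ge).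
by rewrite (negPf kd0).
Qed.

Lemma span_consP d e x : reflect (exists k u, u \in <<e>>%VS /\ x = k *: d + u) (x \in <<d :: e>>%VS).
Proof.
rewrite span_cons; apply: (iffP memv_addP) => [[_ /vlineP[k ->]] [u ue ->]|[k [u [ue ->]]]].
  by exists k, u.
by exists (k *: d); [rewrite rpredZ ?memv_line | exists u].
Qed.

Lemma vindep_cat_gt e' e u' u g : vindep (e' ++ e) -> u' \in <<e'>>%VS -> u \in <<e>>%VS ->
  u' + u \in filt_gt v g -> u' \in filt_gt v g.
Proof.
elim: e' u' => [|d e' IH] u' ind.
  by rewrite span_nil memv0 => /eqP -> _ _; rewrite rpred0.
case/span_consP => k [w [we ->]] ue; rewrite -addrA => sum_gt.
have wu : w + u \in <<e' ++ e>>%VS by rewrite span_cat memv_add.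
have [kd wgt] := vindep_cons_gt ind wu sum_gt.
by rewrite rpredD //; case: ind => _ ind; apply: IH wgt.
Qed.

Lemma vindep_free e : vindep e -> free e.
Proof.
elim: e => [|d e IH ind]; first by rewrite nil_free.
rewrite free_cons; case: ind => ind /IH ->; rewrite andbT.
by apply/negP => /ind/negP[]; rewrite subrr rpred0.
Qed.

(** The leading terms of the elements of U are combinations of those of e. *)
Definition vapprox U e :=
  forall d, d \in U -> d != 0 -> exists2 u, u \in <<e>>%VS & d - u \in filt_gt v (v d).

(** An element of U that cannot be approximated can be added to the family, and
    the dimension of D bounds the length of such an enlargement. *)
Lemma vindep_extend U e : vindep e ->
  exists e', [/\ {subset e' <= U}, vindep (e' ++ e) & vapprox U (e' ++ e)].
Proof.
have [n] := ubnP (\dim {:D} - size e); elim: n e => // n IH e le_n ind.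
have [approx|/existsNP[d /not_implyP[dU /not_implyP[d0 nex]]]] := pselect (vapprox U e).
  by exists [::].
have dind : vindep (d :: e).
  by split=> // u ue; apply/negP => du; case: nex; exists u.
have lt_dim : (size e < \dim {:D})%N.
  by rewrite -[(_ < _)%N]/(size (d :: e) <= _)%N -(eqP (vindep_free dind)) dimvS ?subvf.
have [|e' [sub ind' app]] := IH (d :: e) _ dind.
  by rewrite /= subnS -ltnS prednK ?subn_gt0.
exists (rcons e' d); rewrite cat_rcons; split=> // x.
by rewrite mem_rcons inE => /predU1P[->|/sub].
Qed.

(** No cancellation of leading terms occurs in a combination of the entries of
    e, so the leading term of u is the combination of theirs. *)
Lemma lead_span e u g : vindep e -> u \in <<e>>%VS -> u \in filt_ge v g ->
  exists2 a : nat -> gr v, forall i, gr_sub (v := v) [in 1%VS] (a i) &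
    lead v g u = \sum_(i < size e) lead v (v e`_i) e`_i * a i.
Proof.
have gr0 : gr_sub (v := v) [in 1%VS] 0.
  by rewrite -(lead0 v 0); apply: gr_sub_lead; rewrite ?rpred0 //; apply: mem0v.
elim: e u => [|d e IH] u ind.
  by rewrite span_nil memv0 => /eqP -> _; exists (fun=> 0); rewrite // big_ord0 lead0.
case/span_consP => k [w [we ->]] /(vindep_cons_ge ind we)[kd_ge w_ge].
have d0 := vindep_neq0 ind; case: ind => _ ind.
have [a a_gr aE] := IH w ind we w_ge.
have kge : k%:A \in filt_ge v (g - v d).
  have [->|k0] := eqVneq k 0; first by rewrite scale0r rpred0.
  move: kd_ge; rewrite !filt_geE scaler_eq0 (negPf d0) (negPf k0) (negPf (alg_neq0 k0)) /=.
  by rewrite valZ // -(og_leD2r (v d) (g - _)) subrK.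
exists (fun i => if i is j.+1 then a j else lead v (g - v d) k%:A) => [[|j]|] //.
  by apply: gr_sub_lead; rewrite ?mem0v ?memvZ ?memv_line.
rewrite /= big_ord_recl /= -aE leadD // leadM ?filt_ge_val //.
by rewrite [v d + _]addrC subrK mulr_algr.
Qed.

Lemma vapprox_lead e (x : gr v) : vindep e -> vapprox fullv e ->
  exists2 a : nat -> gr v, forall i, gr_sub (v := v) [in 1%VS] (a i) &
    x = \sum_(i < size e) lead v (v e`_i) e`_i * a i.
Proof.
move=> ind app.
have gr_add a b : gr_sub (v := v) [in 1%VS] a -> gr_sub (v := v) [in 1%VS] b ->
    gr_sub (v := v) [in 1%VS] (a + b).
  move=> [a1 ha ->] [b1 hb ->]; exists (a1 + b1); last by rewrite to_grD.
  by move=> g; rewrite rmorphD mcoeffD rpredD ?ha ?hb.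
have gr0 : gr_sub (v := v) [in 1%VS] 0.
  by rewrite -(lead0 v 0); apply: gr_sub_lead; rewrite ?rpred0 //; apply: mem0v.
rewrite -(to_gr_repr x) to_gr_lead.
elim/big_ind: _ => [|_ _ [a ha ->] [b hb ->]|g _].
- by exists (fun=> 0) => //; rewrite big1 // => i _; rewrite mulr0.
- exists (fun i => a i + b i) => [i|]; first exact: gr_add.
  by rewrite -big_split; apply: eq_bigr => i _; rewrite mulrDr.
set d := mcoeff _ _; have dg : d \in filt_ge v g by exact: filt_sumP.
have [dgt|ndgt] := boolP (d \in filt_gt v g).
  have /eqP -> : lead v g d == 0 by rewrite lead_eq0.
  by exists (fun=> 0) => //; rewrite big1 // => i _; rewrite mulr0.
have [d0 vd] := filt_ge_eq dg ndgt.
have [u ue du] := app d (memvf d) d0; rewrite vd in du.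
have ug : u \in filt_ge v g by rewrite -[u](subKr d) rpredB // filt_gtW.
have -> : lead v g d = lead v g u.
  by apply/eqP; rewrite -subr_eq0 -leadB // lead_eq0 // rpredB.
exact: lead_span.
Qed.

Section Tame.
Hypothesis tame_v : tame v.

(** Tameness is used here through the inclusion of the centre of gr(D) in
    gr(F). *)
Lemma tame_residually_central d : d != 0 ->
    (forall w, w != 0 -> d * w - w * d \in filt_gt v (v d + v w)) ->
  exists k, d - k%:A \in filt_gt v (v d).
Proof.
move=> d0 comm; have [_ cen] := tame_v.
have /cen/(lead_gr_sub (filt_ge_val v d))[s] : central_elt (lead v (v d) d).
  exact: lead_central (filt_ge_val v d) comm.
by case/vlineP => k -> ds; exists k.
Qed.

(** The leading terms of the entries of e generate gr(D) over gr(F). As gr(D)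
    has rank dim D, there are at least dim D of them, and independence over F
    makes e a basis. *)
Lemma vapprox_span e : vindep e -> vapprox fullv e -> <<e>>%VS = fullv.
Proof.
move=> ind app; have [rk cen] := tame_v.
apply/eqP; rewrite eqEdim subvf /=; have /eqP -> := vindep_free ind.
apply: (@centre_rank (gr v) _ _ (fun i => lead v (v e`_i) e`_i)).
  case: rk => E hE; exists E => x; have [c [[c_gr cE] c_uniq]] := hE x.
  exists c; split=> [|c' [hc' c'E]]; first by split=> // i; apply/cen.
  by apply: c_uniq; split=> // i; apply/cen.
move=> x; have [a ha ->] := vapprox_lead x ind app.
by exists (fun i : 'I__ => a i) => // i; apply/cen.
Qed.

(** A maximal independent family e in U extends to an independent basis e' ++ e
    of D. The part along e' of an element of U lies in U, hence is
    approximated by e; independence then forces this part to vanish. *)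
Lemma exists_vindep_basis U : exists2 e, vindep e & <<e>>%VS = U.
Proof.
have [e [eU ind app]] := @vindep_extend U [::] I.
rewrite cats0 in ind app; exists e => //.
have [e' [_ ind' app']] := vindep_extend fullv ind.
have full := vapprox_span ind' app'.
apply/eqP; rewrite eqEsubv (introT span_subvP) //=.
apply/subvP => d dU; have : d \in <<e' ++ e>>%VS by rewrite full memvf.
rewrite span_cat => /memv_addP[u' u'e' [u ue dE]].
suff u'0 : u' = 0 by rewrite dE u'0 add0r.
have [//|u'0] := eqVneq u' 0.
have u'U : u' \in U.
  by rewrite -[u'](addrK u) -dE rpredB //; apply: subvP ue; apply/span_subvP.
have [w we u'w] := app u' u'U u'0.
by have /filt_gt_val := @vindep_cat_gt _ _ _ (- w) _ ind' u'e' (rpredNr we) u'w.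
Qed.
End Tame.
End ValuedAlgebra.

(** * Uniqueness of the extension of a valuation *)

Section Uniqueness.
Variables (F : fieldType) (D : falgType F) (hU : division_ring D).
Variables (G : orderedGroupType) (v w : valuation D G).
Hypothesis (tame_v : tame v) (vw : forall k : F, k != 0 -> w k%:A = v k%:A).

(** Among the terms of x in an independent family for v, one has w-value at most
    w x, while all have v-value at least v x. *)
Lemma val_gap_span (e : seq D) x : vindep v e -> x \in <<e>>%VS -> x != 0 ->
  exists d, [/\ d \in e, d != 0 & w d - v d <= w x - v x].
Proof.
elim: e x => [|d e IH] x ind; first by rewrite span_nil memv0 => ->.
case/span_consP => k [u [ue ->]] x0.
have [kd_ge u_ge] := vindep_cons_ge hU ind ue (filt_ge_val v (k *: d + u)).
have d0 := vindep_neq0 ind.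
have gap a b : a != 0 -> b \in filt_ge v (v (k *: d + u)) -> b != 0 ->
    w a - v a = w b - v b -> w b <= w (k *: d + u) -> w a - v a <= w (k *: d + u) - v (k *: d + u).
  move=> a0 + b0 -> le_w; rewrite filt_geE (negPf b0) /= => le_v.
  by apply: (og_leD le_w); rewrite -(og_leD2l (v b)) subrr -(og_leD2r (v (k *: d + u))) add0r subrK.
have gap_u : u != 0 -> w u <= w (k *: d + u) ->
    exists d', [/\ d' \in d :: e, d' != 0 & w d' - v d' <= w (k *: d + u) - v (k *: d + u)].
  move=> u0 le_u; have [d' [d'e d'0 le_d']] := IH u (proj2 ind) ue u0.
  exists d'; split=> //; first by rewrite inE d'e orbT.
  exact: le_trans le_d' (gap u u u0 u_ge u0 erefl le_u).
have gap_d : k *: d != 0 -> w (k *: d) <= w (k *: d + u) ->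
    exists d', [/\ d' \in d :: e, d' != 0 & w d' - v d' <= w (k *: d + u) - v (k *: d + u)].
  move=> kd0 le_kd; exists d; rewrite mem_head d0; split=> //.
  apply: (gap d (k *: d) d0 kd_ge kd0 _ le_kd).
  have k0 : k != 0 by apply: contraNneq kd0 => ->; rewrite scale0r.
  by rewrite (valZ w k0 d0) (valZ v k0 d0) vw // opprD addrACA subrr add0r.
have [kd0|kd0] := eqVneq (k *: d) 0.
  by apply: gap_u; rewrite ?kd0 ?add0r //; move: x0; rewrite kd0 add0r.
have [u0|u0] := eqVneq u 0; first by apply: gap_d; rewrite ?u0 ?addr0.
have := valD w kd0 u0 x0; rewrite /Order.min; case: ifP => _; [exact: gap_d|exact: gap_u].
Qed.

(** The homomorphism x |-> w x - v x attains a minimum, at an entry of an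
    independent basis. A homomorphism to an ordered group that has a minimum is
    nonnegative, because the square of a minimizing element cannot do better;
    applied to inverses, this shows that it is zero. *)
Lemma val_unique x : x != 0 -> w x = v x.
Proof.
have [e ind e_full] := exists_vindep_basis hU tame_v fullv.
have gapM a b : a != 0 -> b != 0 -> w (a * b) - v (a * b) = (w a - v a) + (w b - v b).
  by move=> a0 b0; rewrite !Defs.valM // opprD addrACA.
have gap_span y : y != 0 -> exists d, [/\ d \in e, d != 0 & w d - v d <= w y - v y].
  by move=> y0; apply: val_gap_span; rewrite ?e_full ?memvf.
have ge0 : forall y, y != 0 -> 0 <= w y - v y.
  have [d1 [d1e d10 _]] := gap_span 1 (oner_neq0 D).
  have [|m + m_min] := @exists_min_seq D G [seq d <- e | d != 0] (fun d => w d - v d).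
    by apply/eqP => e0; have := in_nil d1; rewrite -e0 mem_filter d10 d1e.
  rewrite mem_filter => /andP[m0 me].
  have glob y : y != 0 -> w m - v m <= w y - v y.
    move=> /gap_span[d [de d0]]; apply: le_trans; apply: m_min.
    by rewrite mem_filter d0.
  move=> y /glob; apply: le_trans.
  by have := glob _ (divring_mulf_neq0 hU m0 m0); rewrite gapM // -{1}[_ - _]addr0 og_leD2l.
move=> x0; apply/eqP; rewrite -subr_eq0; apply/eqP/le_anti; rewrite ge0 // andbT.
have := ge0 _ (divring_invr_neq0 hU x0); rewrite !valV // -opprD -(og_leD2l (w x - v x)).
by rewrite addr0 subrr.
Qed.
End Uniqueness.

(** * The Artin-Whaples argument on leading terms *)

Section ArtinWhaples.
Variables (F : fieldType) (D : falgType F) (hU : division_ring D).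
Variables (G : orderedGroupType) (v : valuation D G).

(** In gr(D), homogeneous central elements are leading terms of scalars. *)
Definition residually_central := forall d, d != 0 ->
    (forall w, w != 0 -> d * w - w * d \in filt_gt v (v d + v w)) ->
  exists k : F, d - k%:A \in filt_gt v (v d).

Lemma filt_gt_mid x y z g : y != 0 -> (x * y * z \in filt_gt v (g + v y)) = (x * z \in filt_gt v g).
Proof.
move=> y0; have [->|x0] := eqVneq x 0; first by rewrite !mul0r !rpred0.
have [->|z0] := eqVneq z 0; first by rewrite !mulr0 !rpred0.
have nz := divring_mulf_neq0 hU.
rewrite !filt_gtE (negPf (nz _ _ (nz _ _ x0 y0) z0)) (negPf (nz _ _ x0 z0)) /=.
by rewrite !Defs.valM ?nz // addrAC og_ltD2r.
Qed.

Lemma filt_ge_mid x y z g : y != 0 -> (x * y * z \in filt_ge v (g + v y)) = (x * z \in filt_ge v g).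
Proof.
move=> y0; have [->|x0] := eqVneq x 0; first by rewrite !mul0r !rpred0.
have [->|z0] := eqVneq z 0; first by rewrite !mulr0 !rpred0.
have nz := divring_mulf_neq0 hU.
rewrite !filt_geE (negPf (nz _ _ (nz _ _ x0 y0) z0)) (negPf (nz _ _ x0 z0)) /=.
by rewrite !Defs.valM ?nz // addrAC og_leD2r.
Qed.

Hypothesis res_central : residually_central.

(** Induction on e. If the first term has value exactly g, divide the relation on
    the right by the first coefficient; comparing the relations for y w and
    for y, multiplied by w, eliminates the first term and leaves a relation
    with coefficients [w, m_i]. By induction these are negligible, so the m_i
    agree with scalars up to leading terms, and the relation for y = 1
    contradicts the independence of e. *)
Lemma artin_whaples (e : seq D) (d : nat -> D) (g : G) : vindep v e ->
    (forall i, (i < size e)%N -> e`_i * d i \in filt_ge v g) ->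
    (forall y, y != 0 -> \sum_(i < size e) e`_i * y * d i \in filt_gt v (g + v y)) ->
  forall i, (i < size e)%N -> e`_i * d i \in filt_gt v g.
Proof.
elim: e d g => // l e IH d g ind d_ge sum_gt.
(* a negligible first term can be dropped from the relation *)
suff head : l * d 0%N \in filt_gt v g.
  case=> // i lti; apply: (IH (fun j => d j.+1)) => //; first by case: ind.
    by move=> j ltj; apply: (d_ge j.+1).
  move=> y y0; have := sum_gt y y0; rewrite /= big_ord_recl /= => s_gt.
  by rewrite -[X in X \in _](addKr (l * y * d 0%N)) rpredD ?rpredN // filt_gt_mid.
apply/negPn/negP => nhead.
have [ld0 ldv] := filt_ge_eq (d_ge 0%N isT) nhead.
have l0 := vindep_neq0 ind.
have d0 : d 0%N != 0 by apply: contraNneq ld0 => ->; rewrite mulr0.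
rewrite /= Defs.valM // in ldv; set dh := d 0%N in d0 ldv *.
pose m i := d i.+1 * dh^-1.
have m_ge i : (i < size e)%N -> e`_i * m i \in filt_ge v (v l).
  move=> lti; have := filt_geM (d_ge i.+1 lti) (filt_ge_val v dh^-1).
  by rewrite valV // -ldv addrK mulrA.
have m_gt y : y != 0 -> l * y + \sum_(i < size e) e`_i * y * m i \in filt_gt v (v l + v y).
  move=> y0; have E : (l * y + \sum_(i < size e) e`_i * y * m i) * dh =
      \sum_(i < (size e).+1) (l :: e)`_i * y * d i.
    rewrite big_ord_recl mulrDl mulr_suml; congr (_ + _); apply: eq_bigr => i _ /=.
    by rewrite /m -!mulrA mulVr ?mulr1 ?hU.
  by rewrite -(filt_gt_mulr hU v _ _ d0) E addrAC ldv; apply: sum_gt.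
have comm_gt w i : w != 0 -> (i < size e)%N ->
    e`_i * (w * m i - m i * w) \in filt_gt v (v l + v w).
  move=> w0; apply: (IH (fun j => w * m j - m j * w)) i; first by case: ind.
    move=> j ltj; rewrite mulrBr rpredB //; first by rewrite mulrA filt_ge_mid ?m_ge.
    by rewrite mulrA filt_geM ?m_ge ?filt_ge_val.
  move=> y y0; have yw0 := divring_mulf_neq0 hU y0 w0.
  have := m_gt _ yw0; rewrite Defs.valM // [v y + _]addrC addrA => s1.
  have := filt_gtMl (m_gt _ y0) (filt_ge_val v w); rewrite addrAC => s2.
  have -> : \sum_(j < size e) e`_j * y * (w * m j - m j * w) =
      (l * (y * w) + \sum_(j < size e) e`_j * (y * w) * m j)
      - (l * y + \sum_(j < size e) e`_j * y * m j) * w.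
    rewrite mulrDl mulr_suml !mulrA opprD addrACA subrr add0r -sumrB.
    by apply: eq_bigr => j _; rewrite mulrBr !mulrA.
  exact: rpredB.
have /fin_all_exists[k kE] : forall i : 'I_(size e), exists k : F,
    e`_i * (m i - k%:A) \in filt_gt v (v l).
  move=> i; have [mgt|nmgt] := boolP (e`_i * m i \in filt_gt v (v l)).
    by exists 0; rewrite scale0r subr0.
  have [em0 emv] := filt_ge_eq (m_ge i (ltn_ord i)) nmgt.
  have ei0 : e`_i != 0 by apply: contraNneq em0 => ->; rewrite mul0r.
  have mi0 : m i != 0 by apply: contraNneq em0 => ->; rewrite mulr0.
  rewrite Defs.valM // in emv.
  have [w w0|k mk] := res_central mi0.
    rewrite -(filt_gt_mull hU v _ _ ei0) addrA emv -rpredN -mulrN opprB.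
    exact: comm_gt.
  by exists k; rewrite -emv filt_gt_mull.
have s1 := m_gt 1 (oner_neq0 D); rewrite Defs.val1 addr0 mulr1 in s1.
have s2 : \sum_(i < size e) e`_i * (m i - (k i)%:A) \in filt_gt v (v l).
  by apply: rpred_sum => i _; apply: kE.
have := rpredB s1 s2; rewrite -addrA -sumrB.
under eq_bigr do rewrite mulr1 mulrBr subKr mulr_algr.
rewrite -[X in l + X]opprK; apply/negP; case: ind => ind _; apply: ind.
by rewrite rpredN; apply: rpred_sum => i _; rewrite rpredZ ?memv_span ?mem_nth.
Qed.
End ArtinWhaples.

(** * Linear systems and right combinations *)

Section LinearSystems.
Variables (F : fieldType) (D : falgType F).

Lemma dim_ffun (I : finType) (V : vectType F) : \dim {:{ffun I -> V}} = (#|I| * \dim {:V})%N.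
Proof. by rewrite !dimvf. Qed.

Lemma homogeneous_solution (I J : finType) (A : J -> I -> D) : (#|J| < #|I|)%N ->
  exists2 d : I -> D, exists i, d i != 0 & forall j, \sum_i A j i * d i = 0.
Proof.
move=> ltJI; pose f (d : {ffun I -> D}) : {ffun J -> D} := [ffun j => \sum_i A j i * d i].
have f_lin : linear f.
  move=> k x y; apply/ffunP => j; rewrite !ffunE scaler_sumr -big_split.
  by apply: eq_bigr => i _; rewrite !ffunE mulrDr -scalerAr.
pose fL := GRing.isLinear.Build F _ _ *:%R f f_lin.
pose fl : {linear {ffun I -> D} -> {ffun J -> D}} := HB.pack f fL.
have D_gt0 : (0 < \dim {:D})%N by apply: adim_gt0.
have : lker (linfun fl) != 0%VS.
  rewrite -dimv_eq0; have := limg_ker_dim (linfun fl) fullv.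
  rewrite capfv => dimE; apply/eqP => ker0; move: dimE; rewrite ker0 add0n => dimE.
  have := dimvS (subvf (limg (linfun fl))).
  by rewrite dimE !dim_ffun leq_pmul2r // leqNgt ltJI.
rewrite -vpick0; set d := vpick _ => d0.
have : d \in lker (linfun fl) by apply: memv_pick.
rewrite memv_ker lfunE => /eqP fd; exists d.
  apply/existsP; apply: contraNT d0; rewrite negb_exists => /forallP dz.
  by apply/eqP/ffunP => i; rewrite ffunE; have := dz i; rewrite negbK => /eqP.
by move=> j; have := congr1 (fun h : {ffun J -> D} => h j) fd; rewrite !ffunE.
Qed.
End LinearSystems.

Section RightCombinations.
Variables (F : fieldType) (D : falgType F) (C : {vspace D}) (I : finType) (T : I -> D).

Definition rcomb (c : {ffun I -> subvs_of C}) : D := \sum_i T i * vsval (c i).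

Lemma rcomb_linear : linear rcomb.
Proof.
move=> k x y; rewrite /rcomb scaler_sumr -big_split; apply: eq_bigr => i _.
by rewrite !ffunE linearP mulrDr -scalerAr.
Qed.

HB.instance Definition _ := GRing.isLinear.Build F _ _ *:%R rcomb rcomb_linear.

Lemma limg_rcombP d : reflect (exists2 c : I -> D, forall i, c i \in C & d = \sum_i T i * c i)
  (d \in limg (linfun rcomb)).
Proof.
apply: (iffP memv_imgP) => [[c _ ->]|[c Cc ->]].
  by rewrite lfunE; exists (fun i => vsval (c i)) => // i; apply: subvsP.
exists [ffun i => Subvs (Cc i)]; rewrite ?memvf // lfunE.
by apply: eq_bigr => i _; rewrite ffunE.
Qed.

Lemma dim_rcomb_source : \dim {:{ffun I -> subvs_of C}} = (#|I| * \dim C)%N.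
Proof. by rewrite dim_ffun dimvf. Qed.

Lemma dim_limg_rcomb : (\dim (limg (linfun rcomb)) <= #|I| * \dim C)%N.
Proof. by rewrite -dim_rcomb_source -(limg_ker_dim (linfun rcomb)) leq_addl. Qed.

Lemma rcomb_free_dim :
    (forall c : I -> D, (forall i, c i \in C) -> \sum_i T i * c i = 0 -> forall i, c i = 0) ->
  \dim (limg (linfun rcomb)) = (#|I| * \dim C)%N.
Proof.
move=> fr; rewrite limg_dim_eq ?dim_rcomb_source //; apply/eqP; rewrite capfv.
rewrite -subv0; apply/subvP => c; rewrite memv_ker lfunE memv0 => /eqP c0.
apply/eqP/ffunP => i; apply: val_inj; rewrite ffunE /=.
exact: (fr (fun i => vsval (c i))) (fun i => subvsP _) c0 i.
Qed.
End RightCombinations.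

(** * Total ramification over a centralizer *)

Section TotallyRamified.
Variables (F : fieldType) (D : falgType F) (hU : division_ring D).
Variables (G : orderedGroupType) (v : valuation D G) (M : {vspace D}).
Local Notation C := ('C(M))%VS.
Local Notation GammaC := (value_group v [in C]).
Implicit Types (x y z d m : D) (g h : G).

Lemma centV x : x \in C -> x^-1 \in C.
Proof.
have [->|x0] := eqVneq x 0; first by rewrite invr0.
move/centvP => cx; apply/centvP => y My; apply: (mulrI (hU x0)).
by rewrite mulrA divrr ?hU // mul1r mulrA cx // mulrK ?hU.
Qed.

Lemma centM x y : x \in C -> y \in C -> x * y \in C.
Proof.
move=> /centvP cx /centvP cy; apply/centvP => z Mz.
by rewrite -mulrA cy // !mulrA cx.
Qed.

Lemma GammaC_val x : x \in C -> x != 0 -> GammaC (v x).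
Proof. by exists x. Qed.

Lemma GammaC0 : GammaC 0.
Proof. by rewrite -(Defs.val1 v); apply: GammaC_val; rewrite ?centv1 ?oner_neq0. Qed.

Lemma GammaCN g : GammaC g -> GammaC (- g).
Proof.
move=> [x [Cx x0 <-]]; rewrite -(valV hU) //.
by apply: GammaC_val; rewrite ?centV ?divring_invr_neq0.
Qed.

Lemma GammaCD g h : GammaC g -> GammaC h -> GammaC (g + h).
Proof.
move=> [x [Cx x0 <-]] [y [Cy y0 <-]]; rewrite -Defs.valM //.
by apply: GammaC_val; rewrite ?centM ?divring_mulf_neq0.
Qed.

Lemma GammaCB g h : GammaC g -> GammaC h -> GammaC (g - h).
Proof. by move=> Cg Ch; apply: GammaCD Cg (GammaCN Ch). Qed.

Lemma GammaC_sub_trans g h k : GammaC (g - h) -> GammaC (k - h) -> GammaC (g - k).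
Proof. by move=> gh kh; have := GammaCB gh kh; rewrite opprB addrA subrK. Qed.

(** Representatives of the value group of D modulo that of C which form a basis
    of D as a right C-space. The representative of the trivial coset is
    normalized to 1, so that the coordinate at i0 is an element of C. *)
Record ramification_basis n (T : 'I_n -> D) (i0 : 'I_n) : Prop := {
  ram_neq0 : forall i, T i != 0;
  ram_one : T i0 = 1;
  ram_inj : forall i j, GammaC (v (T i) - v (T j)) -> i = j;
  ram_surj : forall d, d != 0 -> exists i, GammaC (v d - v (T i));
  ram_dim : (n * \dim C)%N = \dim {:D};
  ram_span : forall d, exists2 c : 'I_n -> D, forall i, c i \in C & d = \sum_i T i * c i
}.

Lemma val_rcomb n (T : 'I_n -> D) (c : 'I_n -> D) (r : seq 'I_n) : uniq r ->
    (forall i, T i != 0) -> (forall i j, GammaC (v (T i) - v (T j)) -> i = j) ->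
    (forall i, c i \in C) ->
  {in r, forall i, c i = 0} \/
  exists2 j, j \in r & [/\ c j != 0, \sum_(i <- r) T i * c i != 0 &
    v (\sum_(i <- r) T i * c i) = v (T j) + v (c j)].
Proof.
move=> ur T0 T_inj Cc.
have nz i : T i * c i != 0 -> c i != 0 by apply: contraNneq => ->; rewrite mulr0.
have [i j _ _ ij /nz ci /nz cj|z|[j jr [/nz cj s0 vs]]] :=
    @val_sum_distinct D G v _ r (fun i => T i * c i) ur.
- apply: contraNneq ij; rewrite !Defs.valM // => e.
  apply/eqP/T_inj; suff -> : v (T i) - v (T j) = v (c j) - v (c i) by apply: GammaCB; apply: GammaC_val.
  by apply/eqP; rewrite subr_eq addrAC eq_sym subr_eq addrC -e addrC.
- left=> i /z Tc0; have [//|ci] := eqVneq (c i) 0.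
  by have := divring_mulf_neq0 hU (T0 i) ci; rewrite Tc0 eqxx.
by right; exists j => //; rewrite s0 cj vs Defs.valM.
Qed.

(** Representatives of distinct cosets are right independent over C, because the
    terms of a combination have distinct values; their number is the dimension
    of D over C, so they form a basis. *)
Lemma totally_ramified_basis : totally_ramified v C ->
  exists n T i0, @ramification_basis n T i0.
Proof.
case=> n [E E_basis] [t t_val t_trans].
have [i0 [Ci0 _]] := t_trans 0 (ex_intro _ 1 (And3 (memvf 1) (oner_neq0 D) (Defs.val1 v))).
have /fin_all_exists[T TE] : forall i, exists x,
    [/\ x != 0, GammaC (v x - t i) & (i = i0 -> x = 1)].
  move=> i; have [->|ii0] := eqVneq i i0.
    by exists 1; rewrite oner_neq0 Defs.val1.
  have [x [_ x0 <-]] := t_val i; exists x; rewrite x0 subrr; split=> //; first exact: GammaC0.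
  by move=> e; rewrite e eqxx in ii0.
have T0 i : T i != 0 by case: (TE i).
have T_t i : GammaC (t i - v (T i)).
  by case: (TE i) => _ /GammaCN; rewrite opprB.
have T_inj i j : GammaC (v (T i) - v (T j)) -> i = j.
  move=> ij; have [i1 [_ uniq1]] := t_trans _ (t_val i).
  rewrite -(uniq1 i) ?subrr; last exact: GammaC0; apply: uniq1.
  have := GammaCD (GammaCD (T_t i) ij) (GammaCN (T_t j)).
  by rewrite addrA subrK opprB addrA subrK.
have T_indep (c : 'I_n -> D) : (forall i, c i \in C) -> \sum_i T i * c i = 0 -> forall i, c i = 0.
  move=> Cc s0 i; have [/(_ i (mem_enum _ _))//|[j _ [_ ]]] := val_rcomb (enum_uniq 'I_n) T0 T_inj Cc.
  by rewrite big_enum s0 eqxx.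
have dimT := rcomb_free_dim T_indep.
have dimE : (\dim {:D} <= n * \dim C)%N.
  have <- : limg (linfun (rcomb (C:=C) E)) = fullv.
    apply/vspaceP => d; rewrite memvf; apply/limg_rcombP.
    by have [c [[Cc dc] _]] := E_basis d; exists c.
  by have := dim_limg_rcomb C E; rewrite card_ord.
rewrite card_ord in dimT.
have fullT : limg (linfun (rcomb (C:=C) T)) = fullv.
  by apply/eqP; rewrite eqEdim subvf dimT.
exists n, T, i0; split=> //.
- by case: (TE i0) => _ _ /(_ erefl).
- move=> d d0; have [i [Ci _]] := t_trans (v d) (ex_intro _ d (And3 (memvf d) d0 erefl)).
  exists i; have := GammaCD Ci (T_t i).
  by rewrite addrA subrK.
- by rewrite -dimT fullT.
by move=> d; apply/limg_rcombP; rewrite fullT memvf.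
Qed.

Section Basis.
Variables (n : nat) (T : 'I_n -> D) (i0 : 'I_n).
Hypothesis ram : ramification_basis T i0.

(** The component c is the coordinate at the representative 1 of the trivial
    coset; the value of the rest is that of one of its terms. *)
Lemma ram_decompose d : exists c m, [/\ c \in C, d = c + m & m != 0 -> ~ GammaC (v m)].
Proof.
have [c Cc ->] := ram_span ram d.
exists (c i0), (\sum_(i | i != i0) T i * c i); split=> //.
  by rewrite (bigD1 i0) //= (ram_one ram) mul1r.
set m := \sum_(_ | _) _; move=> m0 Cm.
have mE : m = \sum_(i <- [seq i <- enum 'I_n | i != i0]) T i * c i.
  by rewrite big_filter big_enum_cond.
have [z|[j]] := val_rcomb (filter_uniq (fun i => i != i0) (enum_uniq 'I_n)) (ram_neq0 ram) (ram_inj ram) Cc.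
  move/eqP: m0; case; rewrite mE big_seq big1 // => i /z ->; exact: mulr0.
rewrite mem_filter -mE => /andP[/eqP ji0 _] [cj _ vm]; apply: ji0; apply: (ram_inj ram).
rewrite (ram_one ram) Defs.val1 subr0.
by have := GammaCB Cm (GammaC_val (Cc j) cj); rewrite vm addrK.
Qed.

(** In degrees belonging to the value group of C, gr(D) and gr(C) coincide. *)
Lemma ram_decompose_gt d : GammaC (v d) -> d != 0 ->
  exists c m, [/\ c \in C, d = c + m & m \in filt_gt v (v d)].
Proof.
move=> Cd d0; have [c [m [Cc dE nm]]] := ram_decompose d; exists c, m; split=> //.
apply/negPn/negP; rewrite filt_gtN => /andP[m0 le_md].
have := nm m0; case.
have [e|ne] := eqVneq (v m) (v d); first by rewrite e.
have mN0 : - m != 0 by rewrite oppr_eq0.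
have dgt : d \in filt_gt v (v (- m)) by rewrite valN filt_gtE lt_neqAle ne le_md orbT.
have [] := val_addl mN0 dgt.
by rewrite addrC dE addrK valN => c0 <-; apply: GammaC_val.
Qed.

Hypothesis MC : (M <= C)%VS.
Hypotheses (tame_v : tame v) (dim_le : (\dim {:D} <= \dim M * \dim C)%N).

(** If m commutes with M up to leading terms, so do all elements whose value lies
    in the value group of C or in its coset at v m. Up to such left factors,
    the basis T without its entry in the coset of v m therefore represents all
    of D, and sum_i e_i y d_i is negligible for every y as soon as
    sum_i e_i T_j d_i = 0 for the remaining T_j. These are n - 1 equations in
    dim M unknowns, where n = [D : C] <= dim M, and a nonzero solution
    contradicts artin_whaples. *)
Lemma exists_noncommuting m : m != 0 -> ~ GammaC (v m) ->
  exists l, [/\ l \in M, l != 0 & m * l - l * m \notin filt_gt v (v m + v l)].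
Proof.
move=> m0 nCm; apply: contrapT => nex.
pose almost_central b := forall l, l \in M -> l != 0 -> b * l - l * b \in filt_gt v (v b + v l).
have nz := divring_mulf_neq0 hU.
have acm : almost_central m.
  by move=> l Ml l0; apply/negPn/negP => h; case: nex; exists l.
have acC b : b != 0 -> GammaC (v b) -> almost_central b.
  move=> b0 Cb l Ml l0; have [c [x [/centvP Cc bE xgt]]] := ram_decompose_gt Cb b0.
  rewrite {1 2}bE mulrDl mulrDr Cc // opprD addrACA subrr add0r rpredB //.
    by rewrite filt_gtMl ?filt_ge_val.
  by rewrite addrC filt_gtMr ?filt_ge_val.
have acM a b : a != 0 -> b != 0 -> almost_central a -> almost_central b -> almost_central (a * b).
  move=> a0 b0 aca acb l Ml l0.
  have -> : a * b * l - l * (a * b) = a * (b * l - l * b) + (a * l - l * a) * b.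
    by rewrite mulrBr mulrBl !mulrA addrA subrK.
  rewrite Defs.valM // rpredD //.
    by rewrite -addrA filt_gtMr ?filt_ge_val ?acb.
  by rewrite addrAC filt_gtMl ?filt_ge_val ?aca.
have [i1 Ci1] := ram_surj ram m0.
have i01 : i0 != i1.
  by apply: contra_not_neq nCm => e; move: Ci1; rewrite -e (ram_one ram) Defs.val1 subr0.
(* i0 replaces i1: the left factor then has value in the coset of v m *)
have cover y : y != 0 -> exists i b, [/\ i != i1, b != 0, y = b * T i & almost_central b].
  move=> y0; have [i Ci] := ram_surj ram y0; have Ti0 := ram_neq0 ram i.
  have [ii1|ii1] := eqVneq i i1; last first.
    exists i, (y * (T i)^-1); rewrite ii1 mulrVK ?hU // nz ?divring_invr_neq0 //; split=> //.
    by apply: acC; rewrite ?nz ?Defs.valM ?valV ?divring_invr_neq0.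
  have mV0 := divring_invr_neq0 hU m0.
  exists i0, y; rewrite i01 (ram_one ram) mulr1; split=> //.
  rewrite -[y](mulVKr (hU m0)); apply: (acM) => //; first exact: nz.
  apply: acC; rewrite ?nz // Defs.valM // valV // addrC.
  by apply: GammaC_sub_trans Ci _; rewrite ii1.
have [e ind eM] := exists_vindep_basis hU tame_v M.
have size_e : (n <= size e)%N.
  have /eqP <- := vindep_free ind; rewrite eM.
  have C_gt0 : (0 < \dim C)%N.
    rewrite lt0n dimv_eq0; apply: contraTneq (centv1 M) => ->.
    by rewrite memv0 oner_eq0.
  by rewrite -(leq_pmul2r C_gt0) (ram_dim ram).
have lt_n : (#|{: {j : 'I_n | j != i1}}| < #|'I_(size e)|)%N.
  rewrite card_sig card_ord; apply: leq_trans size_e.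
  by rewrite cardC1 card_ord prednK // (leq_ltn_trans _ (ltn_ord i1)).
have [d [i2 d0] dE] := homogeneous_solution (fun (j : {j : 'I_n | j != i1}) (i : 'I_(size e)) => e`_i * T (val j)) lt_n.
have [|i3 + i3_min] := @exists_min_seq _ G [seq i <- enum 'I_(size e) | d i != 0]
    (fun i => v e`_i + v (d i)).
  by apply/eqP => h; have := in_nil i2; rewrite -h mem_filter d0 mem_enum.
rewrite mem_filter => /andP[d30 _]; pose g := v e`_i3 + v (d i3).
have e0 i : (i < size e)%N -> e`_i != 0.
  by move=> lti; apply: (free_not0 (vindep_free ind)); apply: mem_nth.
have g_le i : d i != 0 -> g <= v e`_i + v (d i).
  by move=> di; apply: i3_min; rewrite mem_filter di mem_enum.
(* the coefficients, extended by 0 beyond the length of e *)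
pose d' i := if insub i is Some j then d j else 0.
have d'E (i : 'I_(size e)) : d' i = d i by rewrite /d' valK.
have d'_ge i : (i < size e)%N -> e`_i * d' i \in filt_ge v g.
  move=> lti; rewrite -[i]/(val (Ordinal lti)) d'E.
  have [->|di] := eqVneq (d (Ordinal lti)) 0; first by rewrite mulr0 rpred0.
  by rewrite filt_geE Defs.valM ?e0 // g_le // orbT.
have d'_gt y : y != 0 -> \sum_(i < size e) e`_i * y * d' i \in filt_gt v (g + v y).
  move=> y0; have [j [b [ji1 b0 yE acb]]] := cover y y0.
  have -> : \sum_(i < size e) e`_i * y * d' i =
      b * (\sum_(i < size e) e`_i * T j * d i)
      - \sum_(i < size e) (b * e`_i - e`_i * b) * (T j * d i).
    rewrite mulr_sumr -sumrB; apply: eq_bigr => i _; rewrite d'E yE.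
    by rewrite mulrBl opprB !mulrA addrC subrK.
  rewrite (dE (exist _ j ji1)) mulr0 sub0r rpredN; apply: rpred_sum => i _.
  have [->|di] := eqVneq (d i) 0; first by rewrite !mulr0 rpred0.
  have Mei : e`_i \in M by rewrite -eM memv_span ?mem_nth.
  apply: filt_gt_le (filt_gtMl (acb _ Mei (e0 _ (ltn_ord i))) (filt_ge_val v (T j * d i))).
  rewrite yE !Defs.valM ?(ram_neq0 ram) // [X in _ <= X]addrACA [X in _ <= X]addrC og_leD2r.
  exact: g_le.
have := artin_whaples hU (tame_residually_central tame_v) ind d'_ge d'_gt (ltn_ord i3).
rewrite d'E filt_gtE (negPf (nz _ _ (e0 _ (ltn_ord i3)) d30)) Defs.valM ?e0 //.
by rewrite ltxx.
Qed.

(** Write z = c + m by ram_decompose. With r z = z l one has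
    (r - l) z = [m, l]; a suitable l makes the value of the right-hand side
    v m + v l, so v m would belong to the value group of C. *)
Lemma normalizer_in_C z : z != 0 -> (forall l, l \in M -> exists2 r, r \in M & z * l = r * z) ->
  GammaC (v z) -> z \in C.
Proof.
move=> z0 norm Cz; have [c [m [Cc zE nm]]] := ram_decompose z.
have [m0|m0] := eqVneq m 0; first by rewrite zE m0 addr0.
have nCm := nm m0; have [l [Ml l0 nlm]] := exists_noncommuting m0 nCm.
have ge_lm : m * l - l * m \in filt_ge v (v m + v l).
  by rewrite rpredB //; [|rewrite addrC]; rewrite filt_geM ?filt_ge_val.
have [lm0 vlm] := filt_ge_eq ge_lm nlm.
have [r Mr zl] := norm l Ml.
have E : (r - l) * z = m * l - l * m.
  rewrite mulrBl -zl zE mulrDl mulrDr (centvP Cc) //.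
  by rewrite opprD addrACA subrr add0r.
have rl0 : r - l != 0 by apply: contraNneq lm0 => rl0; rewrite -E rl0 mul0r.
case: nCm; have -> : v m = v (r - l) + v z - v l.
  by rewrite -Defs.valM // E vlm addrK.
have inC x : x \in M -> x \in C by apply/subvP.
by apply: GammaCB; [apply: GammaCD => //|]; apply: GammaC_val; rewrite ?inC ?rpredB.
Qed.
End Basis.
End TotallyRamified.

(** * Eigenspaces of the Galois group *)

Section GaloisDual.
Variables (F : fieldType) (L : splittingFieldType F).

(** The elements sum_k a k i (x) w k of L (x) L are the idempotents of the
    decomposition of L (x) L into copies of L indexed by the Galois group. *)
Record galois_dual n (g : 'I_n -> gal_of {:L}) (w : 'I_n -> L) (a : 'I_n -> 'I_n -> L) : Prop := {
  gd_dim : \dim {:L} = n;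
  gd_inj : injective g;
  gd_one : exists i, g i = 1%g;
  gd_span : forall x : L, exists c : 'I_n -> F, x = \sum_k c k *: w k;
  gd_dual : forall i j, \sum_k a k i * g j (w k) = (i == j)%:R;
  gd_dualV : forall k l, \sum_i a k i * g i (w l) = (k == l)%:R
}.

(** By Dedekind independence the matrix of the g_i(w_k) is invertible; a is its
    inverse. *)
Lemma exists_galois_dual : galois 1 {:L} -> exists n g w a, @galois_dual n g w a.
Proof.
move=> hL; pose A := 'Gal({:L} / 1)%g.
have [w [_ _] [uM _ /(_ (groupP _))spanE]] := gal_matrix A.
set M := (X in X \in unitmx) in uM.
exists #|A|, (fun i => enum_val i), (fun i => tnth w i), (fun k i => invmx M k i); split.
- by have := galois_dim hL; rewrite dimv1 divn1.
- exact: enum_val_inj.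
- by exists (enum_rank_in (group1 'Gal({:L} / 1)%G) 1%g); rewrite enum_rankK_in ?group1.
- move=> x; have : x \in (\sum_i fixedField A * <[tnth w i]>)%VS by rewrite spanE memvf.
  rewrite (galois_fixedField hL) => /memv_sumP[u u_in ->].
  have /fin_all_exists[c cE] : forall k : 'I_#|A|, exists c : F, u k = c *: tnth w k.
    by move=> k; have := u_in k isT; rewrite prod1v => /vlineP.
  by exists c; apply: eq_bigr => k _; rewrite cE.
- move=> i j; have := congr1 (fun X : 'M_#|A| => X j i) (mulmxV uM); rewrite !mxE eq_sym => <-.
  by apply: eq_bigr => k _; rewrite mxE mulrC.
move=> k l; have := congr1 (fun X : 'M_#|A| => X k l) (mulVmx uM); rewrite !mxE => <-.
by apply: eq_bigr => i _; rewrite mxE.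
Qed.

Section Coefficients.
Variables (n : nat) (g : 'I_n -> gal_of {:L}) (w : 'I_n -> L) (a : 'I_n -> 'I_n -> L).
Hypothesis gd : galois_dual g w a.

(** In L (x) L, multiplying the i-th idempotent by 1 (x) l or by g_i(l) (x) 1
    gives the same result; this is the equality of coefficients of w k. *)
Lemma dual_coef_semilinear (l : L) (c : 'I_n -> 'I_n -> F) i k :
  (forall j, w j * l = \sum_m c j m *: w m) -> \sum_j c j k *: a j i = a k i * g i l.
Proof.
move=> cE.
have gE i' j : g i' (w j) * g i' l = \sum_m c j m *: g i' (w m).
  by rewrite -[LHS]rmorphM cE /= linear_sum; apply: eq_bigr => m _; rewrite linearZ.
transitivity (\sum_j \sum_m c j m *: (a j i * \sum_i' a k i' * g i' (w m))).
  apply: eq_bigr => j _; rewrite (bigD1 k) //= (gd_dualV gd) eqxx mulr1 big1 ?addr0 // => m mk.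
  by rewrite (gd_dualV gd) eq_sym (negPf mk) mulr0 scaler0.
transitivity (\sum_i' a k i' * ((\sum_j a j i * g i' (w j)) * g i' l)).
  under [RHS]eq_bigr do rewrite mulr_suml mulr_sumr.
  rewrite [RHS]exchange_big; apply: eq_bigr => j _ /=.
  under [RHS]eq_bigr do rewrite -mulrA gE !mulr_sumr.
  rewrite [RHS]exchange_big; apply: eq_bigr => m _ /=.
  rewrite mulr_sumr scaler_sumr; apply: eq_bigr => i' _.
  by rewrite -!scalerAr mulrCA.
rewrite (bigD1 i) //= (gd_dual gd) eqxx mul1r big1 ?addr0 // => j ji.
by rewrite (gd_dual gd) eq_sym (negPf ji) mul0r mulr0.
Qed.

(** The idempotents sum to 1. *)
Lemma dual_coef_trace (b : 'I_n -> F) k : 1 = \sum_l b l *: w l -> \sum_i a k i = (b k)%:A.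
Proof.
move=> bE.
transitivity (\sum_i a k i * g i 1).
  by apply: eq_bigr => i _; rewrite rmorph1 mulr1.
have gE i : a k i * g i 1 = \sum_l b l *: (a k i * g i (w l)).
  by rewrite bE linear_sum mulr_sumr; apply: eq_bigr => l _; rewrite linearZ -scalerAr.
under eq_bigr do rewrite gE.
rewrite exchange_big (bigD1 k) //= -scaler_sumr (gd_dualV gd) eqxx big1 ?addr0 // => l lk.
by rewrite -scaler_sumr (gd_dualV gd) eq_sym (negPf lk) scaler0.
Qed.

Lemma gal_quotient i j : exists f : L -> L, forall l, g i (f l) = g j l.
Proof.
exists (fun l => ((g i)^-1)%g (g j l)) => l.
by rewrite -galM ?memvf // mulVg gal_id.
Qed.

Variables (D : falgType F) (iota : 'AHom(L, D)).
Local Notation C := ('C(limg iota))%VS.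

Lemma iotaM l l' : iota (l * l') = iota l * iota l'.
Proof. exact: rmorphM. Qed.

Lemma iotaZ (c : F) l : iota (c *: l) = c *: iota l.
Proof. exact: linearZ. Qed.

Lemma iota_sum I (r : seq I) (P : pred I) (f : I -> L) :
  iota (\sum_(i <- r | P i) f i) = \sum_(i <- r | P i) iota (f i).
Proof. exact: linear_sum. Qed.

Definition eigen i (x : D) := forall l, x * iota l = iota (g i l) * x.

Definition eigen_proj i (x : D) : D := \sum_k iota (a k i) * x * iota (w k).

Lemma centiP x : reflect (forall l, x * iota l = iota l * x) (x \in C).
Proof.
apply: (iffP centvP) => cx l; first by rewrite cx // memv_img ?memvf.
by case/memv_imgP => y _ ->.
Qed.

Lemma eigen_projP i x : eigen i (eigen_proj i x).
Proof.
move=> l; have /fin_all_exists[c cE] := fun j => gd_span gd (w j * l).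
rewrite /eigen_proj mulr_suml mulr_sumr.
transitivity (\sum_k \sum_j iota (c k j *: a k i) * x * iota (w j)).
  apply: eq_bigr => k _; rewrite -[LHS]mulrA -iotaM cE iota_sum mulr_sumr.
  by apply: eq_bigr => j _; rewrite !iotaZ -!scalerAl -scalerAr.
rewrite exchange_big; apply: eq_bigr => k _ /=.
rewrite -mulr_suml -mulr_suml -iota_sum (dual_coef_semilinear _ _ cE) /=.
by rewrite iotaM !mulrA -!iotaM /= [a k i * _]mulrC.
Qed.

Lemma eigen_proj_sum x : x = \sum_i eigen_proj i x.
Proof.
have [b bE] := gd_span gd 1; rewrite /eigen_proj exchange_big /=.
under eq_bigr do rewrite -mulr_suml -mulr_suml -iota_sum (dual_coef_trace _ bE) /=.
have {1}-> : x = x * iota 1 by rewrite rmorph1 mulr1.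
rewrite [in LHS]bE iota_sum mulr_sumr; apply: eq_bigr => k _.
by rewrite !iotaZ rmorph1 -scalerAr mulr_algl -scalerAl.
Qed.

Lemma eigen_proj_comm i x l : iota l * eigen_proj i x = eigen_proj i (iota l * x).
Proof.
rewrite /eigen_proj mulr_sumr; apply: eq_bigr => k _.
by rewrite !mulrA -!iotaM /= mulrC.
Qed.

Lemma eigen_proj_commr i x l : eigen_proj i x * iota l = eigen_proj i (x * iota l).
Proof.
rewrite /eigen_proj mulr_suml; apply: eq_bigr => k _.
by rewrite -!mulrA -!iotaM /= mulrC.
Qed.

Lemma eigen_proj_is_additive i : {morph eigen_proj i : x y / x + y}.
Proof.
move=> x y; rewrite /eigen_proj -big_split; apply: eq_bigr => k _.
by rewrite mulrDr mulrDl.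
Qed.

Lemma eigen_proj_id i x : eigen i x -> eigen_proj i x = x.
Proof.
move=> ex; rewrite /eigen_proj.
under eq_bigr do rewrite -mulrA ex mulrA -iotaM.
by rewrite -mulr_suml -iota_sum (gd_dual gd) eqxx rmorph1 mul1r.
Qed.

Lemma eigenV_mul (hU : division_ring D) i j x y f : x != 0 -> eigen i x -> eigen j y ->
  (forall l, g i (f l) = g j l) -> forall l, x^-1 * y * iota l = iota (f l) * (x^-1 * y).
Proof.
move=> x0 ex ey fE l; apply: (mulrI (hU _ x0)).
by rewrite !mulrA ex divrr ?hU // mul1r fE mulrK ?hU // ey.
Qed.

(** D is the sum of the eigenspaces, and each of them is z_i C for any nonzero
    z_i in it. *)
Lemma eigen_dim (hU : division_ring D) : (\dim {:D} <= n * \dim C)%N.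
Proof.
have /fin_all_exists[z zE] : forall i, exists z, forall x, eigen i x -> exists2 c, c \in C & x = z * c.
  move=> i; have [[z [z0 ez]]|nz] := pselect (exists z, z != 0 /\ eigen i z); last first.
    exists 0 => x ex; exists 0; rewrite ?mem0v // mul0r.
    by apply: contrapT => /eqP x0; apply: nz; exists x.
  exists z => x ex; exists (z^-1 * x); last by rewrite mulVKr ?hU.
  apply/centiP => l; exact: (@eigenV_mul hU i i z x id).
have <- : limg (linfun (rcomb (C:=C) z)) = fullv.
  apply/vspaceP => d; rewrite memvf; apply/limg_rcombP.
  have /fin_all_exists2[c Cc cE] := fun i => zE i _ (eigen_projP i d).
  by exists c => //; rewrite {1}[d]eigen_proj_sum; apply: eq_bigr.
by have := dim_limg_rcomb C z; rewrite card_ord.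
Qed.
End Coefficients.
End GaloisDual.

(** * The action of the tensor product *)

Section TensorAction.
Variables (F : fieldType) (D : falgType F) (L : fieldExtType F) (iota : 'AHom(L, D)).
Local Notation e := (vbasis {:D}).
Implicit Types (t u : tensor D L) (y : D).

Definition tens_act t y : D := \sum_(i < \dim {:D}) e`_i * y * iota (t i).

Lemma tens_act_tens a b y : tens_act (tens a b) y = a * y * iota b.
Proof.
rewrite [in RHS](coord_vbasis (memvf a)) !mulr_suml; apply: eq_bigr => i _.
by rewrite ffunE linearZ /= -scalerAr -!scalerAl.
Qed.

Lemma tens_act_sum I (r : seq I) (P : pred I) (f : I -> tensor D L) y :
  tens_act (\sum_(i <- r | P i) f i) y = \sum_(i <- r | P i) tens_act (f i) y.
Proof.
rewrite /tens_act exchange_big; apply: eq_bigr => k _ /=.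
by rewrite sum_ffunE linear_sum mulr_sumr.
Qed.

Lemma tens_actM t u y : tens_act (t * u) y = tens_act t (tens_act u y).
Proof.
rewrite -[t * u]/(tens_mul t u) /tens_mul tens_act_sum; apply: eq_bigr => i _.
rewrite tens_act_sum /tens_act mulr_sumr mulr_suml; apply: eq_bigr => j _.
by rewrite -/(tens_act _ _) tens_act_tens [t i * _]mulrC rmorphM !mulrA.
Qed.

Lemma tens_act_map (s : D -> D) t y :
  tens_act (tens_map s (idfun : L -> L) t) y = \sum_(i < \dim {:D}) s e`_i * y * iota (t i).
Proof. by rewrite /tens_map tens_act_sum; apply: eq_bigr => i _; rewrite tens_act_tens. Qed.

(** This is artin_whaples for the trivial valuation, for which leading terms are
    the elements themselves and independence is linear independence. *)
Lemma tens_act_faithful (G : orderedGroupType) t : central_division_algebra D ->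
  (forall y, tens_act t y = 0) -> t = 0.
Proof.
case=> hU cenD t0.
have v0M (x y : D) : x != 0 -> y != 0 -> (0 : G) = 0 + 0 by rewrite addr0.
have v0D (x y : D) : x != 0 -> y != 0 -> x + y != 0 -> Order.min (0 : G) 0 <= 0.
  by rewrite minxx.
pose v0 : valuation D G := Valuation v0M v0D.
have gt0 x : x \in filt_gt v0 0 -> x = 0 by rewrite filt_gtE ltxx orbF => /eqP.
have rc : residually_central v0.
  move=> d d0 comm; have : d \in ('Z({:D}))%VS.
    rewrite memv_cap memvf; apply/centvP => w _.
    have [->|w0] := eqVneq w 0; first by rewrite mulr0 mul0r.
    apply/eqP; rewrite -subr_eq0; apply/eqP/gt0.
    by have := comm w w0; rewrite /= addr0.
  by rewrite cenD => /vlineP[k ->]; exists k; rewrite subrr rpred0.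
have ind : vindep v0 e.
  have := basis_free (vbasisP {:D}); elim: (tval e) => //= d s IH.
  rewrite free_cons => /andP[ds /IH ind]; split=> // u us.
  by apply: contra ds => /gt0/eqP; rewrite subr_eq0 => /eqP ->.
pose d i := if insub i is Some j then iota (t j) else 0.
have dE (j : 'I_(\dim {:D})) : d j = iota (t j) by rewrite /d valK.
have d_ge i : (i < size e)%N -> e`_i * d i \in filt_ge v0 0.
  by rewrite filt_geE lexx orbT.
have d_gt y : y != 0 -> \sum_(i < size e) e`_i * y * d i \in filt_gt v0 (0 + v0 y).
  move=> _; suff -> : \sum_(i < size e) e`_i * y * d i = 0 by rewrite rpred0.
  by rewrite size_tuple -[RHS](t0 y); apply: eq_bigr => i _; rewrite dE.
apply/ffunP => j; rewrite ffunE.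
have ltj : (j < size e)%N by rewrite size_tuple.
have /gt0 := artin_whaples hU rc ind d_ge d_gt ltj; rewrite dE => ed0.
have e0 : e`_j != 0 by apply: (free_not0 (basis_free (vbasisP {:D}))); apply: mem_nth.
apply/eqP; rewrite -(fmorph_eq0 iota); apply/eqP/(mulrI (hU _ e0)); by rewrite mulr0.
Qed.
End TensorAction.

(** * Involutions of the first kind *)

Section Involution.
Variables (F : fieldType) (D : falgType F) (sigma : D -> D).
Hypothesis hsigma : first_kind_involution sigma.

Lemma involutionD : {morph sigma : x y / x + y}.
Proof. by case: hsigma => lin _ _ x y; have := lin 1 x y; rewrite !scale1r. Qed.

Lemma involution0 : sigma 0 = 0.
Proof. by apply: (addrI (sigma 0)); rewrite -involutionD !addr0. Qed.

Lemma involution_sum I (r : seq I) (f : I -> D) :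
  sigma (\sum_(i <- r) f i) = \sum_(i <- r) sigma (f i).
Proof. exact: (big_morph sigma involutionD involution0). Qed.

Lemma involution1 : sigma 1 = 1.
Proof.
case: hsigma => _ sM sK; rewrite -[LHS]mulr1 -{2}(sK 1) -sM.
by rewrite mulr1 sK.
Qed.

Lemma involution_alg (k : F) : sigma k%:A = k%:A.
Proof.
case: hsigma => lin _ _; have := lin k 1 0.
by rewrite !addr0 involution0 addr0 involution1.
Qed.

Lemma involution_neq0 x : x != 0 -> sigma x != 0.
Proof.
case: hsigma => _ _ sK; apply: contra_neq => sx0.
by rewrite -(sK x) sx0 involution0.
Qed.

(** v o sigma is again a valuation, and sigma fixes the scalars. *)
Lemma val_involution (hU : division_ring D) (G : orderedGroupType) (v : valuation D G) :
  tame v -> forall x, x != 0 -> v (sigma x) = v x.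
Proof.
move=> tame_v; case: (hsigma) => _ sM _.
have wM x y : x != 0 -> y != 0 -> v (sigma (x * y)) = v (sigma x) + v (sigma y).
  by move=> x0 y0; rewrite sM Defs.valM ?involution_neq0 // addrC.
have wD x y : x != 0 -> y != 0 -> x + y != 0 ->
    Order.min (v (sigma x)) (v (sigma y)) <= v (sigma (x + y)).
  move=> x0 y0 xy0; rewrite involutionD; apply: valD; rewrite ?involution_neq0 //.
  by rewrite -involutionD involution_neq0.
apply: (@val_unique _ _ hU _ v (Valuation wM wD) tame_v) => k k0 /=.
by rewrite involution_alg.
Qed.
End Involution.

Theorem corollary3p6 (F : fieldType) (D : falgType F)
    (hD : central_division_algebra D)
    (Gamma : orderedGroupType) (v : valuation F Gamma) (vD : valuation D Gamma)
    (hv : extends vD v) (htame : tame vD)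
    (sigma : D -> D) (hsigma : first_kind_involution sigma)
    (L : splittingFieldType F) (hL : galois 1 {:L}) (iota : 'AHom(L, D))
    (hsym : forall l : L, sigma (iota l) = iota l)
    (htot : totally_ramified vD 'C(limg iota)) :
  anisotropic (tens_map sigma (idfun : L -> L) : tensor D L -> tensor D L).
Proof.
have hU : division_ring D := proj1 hD.
have nz := divring_mulf_neq0 hU.
have [_ sM sK] := hsigma.
have [n [g [w [a gd]]]] := exists_galois_dual hL.
have [m [T [i0 ram]]] := totally_ramified_basis hU htot.
have MC : (limg iota <= 'C(limg iota))%VS.
  apply/centvsP => _ _ /memv_imgP[l _ ->] /memv_imgP[l' _ ->].
  by rewrite -!rmorphM mulrC.
have dim_le : (\dim {:D} <= \dim (limg iota) * \dim 'C(limg iota))%N.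
  rewrite limg_dim_eq ?(gd_dim gd); first exact: (eigen_dim gd iota hU).
  by apply/eqP; rewrite capfv; apply: AHom_lker0.
(* the quotient of two eigenvectors of equal value normalizes L, hence lies in C *)
have val_eigen i j x y : x != 0 -> y != 0 -> eigen g iota i x -> eigen g iota j y ->
    vD x = vD y -> i = j.
  move=> x0 y0 ex ey vxy; have [f fE] := gal_quotient g i j.
  have zE := eigenV_mul hU x0 ex ey fE; set z := x^-1 * y in zE.
  have xV0 := divring_invr_neq0 hU x0.
  have z0 : z != 0 by apply: nz.
  have : z \in 'C(limg iota)%VS.
    apply: (normalizer_in_C hU ram MC htame dim_le z0).
      by move=> _ /memv_imgP[l _ ->]; exists (iota (f l)); rewrite ?zE // memv_img ?memvf.
    by rewrite Defs.valM // valV // vxy addNr; apply: GammaC0.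
  move=> /centiP zC; apply: (gd_inj gd); apply/eqP/gal_eqP => l _; rewrite -fE; congr (g i _).
  have /(mulIr (hU _ z0)) : iota l * z = iota (f l) * z by rewrite -zC zE.
  by move/(lker0P (AHom_lker0 iota)).
have val_sigma := val_involution hsigma hU htame.
move=> t tt0; apply: (tens_act_faithful (iota := iota) Gamma hD) => y.
set Y := tens_act iota t y; pose Yi i := eigen_proj w a iota i Y.
have eY i : eigen g iota i (Yi i) by apply: eigen_projP.
have sY i l : sigma (Yi i) * iota (g i l) = iota l * sigma (Yi i).
  by rewrite -{1}hsym -sM -eY sM hsym.
have [i1 gi1] := gd_one gd.
pose s := eigen_proj w a iota i1.
have s0 : s 0 = 0 by rewrite /s /eigen_proj big1 // => k _; rewrite mulr0 mul0r.
have s_sum I (r : seq I) (f : I -> D) : s (\sum_(i <- r) f i) = \sum_(i <- r) s (f i).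
  by apply: (big_morph s _ s0) => x x'; apply: eigen_proj_is_additive.
have sYY : s (sigma Y * Y) = 0.
  transitivity (s (sigma y * tens_act iota (tens_map sigma (idfun : L -> L) t * t) y)); last first.
    by rewrite tt0 /tens_act big1 ?mulr0 // => k _; rewrite ffunE rmorph0 mulr0.
  have sYE : sigma Y = \sum_(k < \dim {:D}) iota (t k) * (sigma y * sigma (vbasis {:D})`_k).
    rewrite /Y /tens_act (involution_sum hsigma); apply: eq_bigr => k _.
    by rewrite !sM hsym.
  rewrite tens_actM -/Y tens_act_map sYE mulr_suml mulr_sumr !s_sum.
  apply: eq_bigr => k _; pose X := sigma y * sigma (vbasis {:D})`_k * Y.
  transitivity (s (iota (t k) * X)); first by rewrite /X !mulrA.
  transitivity (s (X * iota (t k))); last by rewrite /X !mulrA.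
  by rewrite /s -eigen_proj_comm -eigen_proj_commr (eigen_projP gd) gi1 gal_id.
have diag i : s (sigma (Yi i) * Yi i) = sigma (Yi i) * Yi i.
  apply: (eigen_proj_id gd) => l; rewrite gi1 gal_id -mulrA eY.
  by rewrite mulrA sY mulrA.
have offdiag i j : i != j -> s (sigma (Yi i) * Yi j) = 0.
  move=> ij; have [f fE] := gal_quotient g i j; set x := sigma (Yi i) * Yi j.
  have xE l : x * iota l = iota (f l) * x by rewrite -mulrA eY mulrA -fE sY mulrA.
  have sxE : s x = iota (\sum_k a k i1 * f (w k)) * x.
    rewrite iota_sum mulr_suml; apply: eq_bigr => k _.
    by rewrite -mulrA xE mulrA iotaM.
  clearbody x; apply/eqP; apply: contraNT ij => sx0.
  apply/eqP/(gd_inj gd)/eqP/gal_eqP => l _; rewrite -fE; congr (g i _).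
  apply: (lker0P (AHom_lker0 iota)); apply: (mulIr (hU _ sx0)).
  have := eigen_projP gd iota i1 x l; rewrite gi1 gal_id -/s => <-.
  by rewrite sxE -!mulrA xE !mulrA -!iotaM mulrC.
have sum0 : \sum_(i <- enum 'I_n) sigma (Yi i) * Yi i = 0.
  have YE : Y = \sum_i Yi i by apply: (eigen_proj_sum gd).
  rewrite big_enum -[RHS]sYY YE (involution_sum hsigma) mulr_suml s_sum; apply: eq_bigr => i _.
  rewrite [in RHS]mulr_sumr s_sum (bigD1 i) //= diag big1 ?addr0 // => j ji.
  by rewrite offdiag // eq_sym.
have prod0 x : sigma x * x = 0 -> x = 0.
  move=> sx0; apply/eqP; apply: contraPT sx0 => x0; apply/eqP/nz => //.
  exact: (involution_neq0 hsigma).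
have val_prod x : x != 0 -> vD (sigma x * x) = vD x + vD x.
  by move=> x0; rewrite Defs.valM ?val_sigma // (involution_neq0 hsigma).
have nz_prod x : sigma x * x != 0 -> x != 0 by apply: contraNneq => ->; rewrite mulr0.
have [i j _ _ ij /nz_prod Yi0 /nz_prod Yj0|z|[j _ [_ /eqP[]//]]] :=
    @val_sum_distinct D Gamma vD _ (enum 'I_n) (fun i => sigma (Yi i) * Yi i) (enum_uniq _).
  rewrite !val_prod //; apply: contraNneq ij => /og_dbl_inj vij.
  by apply/eqP/(val_eigen i j (Yi i) (Yi j)).
rewrite (eigen_proj_sum gd iota Y) big1 // => i _.
by apply: prod0; apply: z; rewrite mem_enum.
Qed.
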